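(* Let $(L,A)$ be an SH Lie pair with quotient $B=L/A$. Then the graded vector space $\mathrm{H}^\bullet_{\mathrm{CE}}(A,(L/A)[-2])$ with the binary operation induced by the Atiyah operator $\bm{\alpha}^{L/A}$, namely $[[x],[y]]=[\bm{\alpha}^{L/A}(x)y]$, is a (graded) Lie algebra. Furthermore, if $E$ is an $A$-module, then $\mathrm{H}^\bullet_{\mathrm{CE}}(A,E)$ is a Lie algebra module over $\mathrm{H}^\bullet_{\mathrm{CE}}(A,(L/A)[-2])$, with the action induced by the Atiyah operator $\bm{\alpha}^E$, namely $[x]\triangleright[r]=[\bm{\alpha}^E(x)r]$.
   Context: Conventions. $\mathbb{K}$ is a field of characteristic zero; graded means $\mathbb{Z}$-graded; $|v|$ is the degree of $v$; $V[k]^n=V^{n+k}$; $V^\vee$ is the graded dual, $(V^\vee)^n=(V^{-n})^*$; graded vector spaces whose duals are used are finite-dimensional. $\mathrm{Hom}(V,W)\cong V^\vee\otimes W$ via $(\xi\otimes w)(v)=(-1)^{|v||w|}\xi(v)w$. $\mathcal{O}(V)=\prod_{n\ge 0}S^n(V^\vee)$ is the algebra of formal power series on $V$ (completed graded symmetric algebra, product formed degree by degree), with product $\odot$. Elements of $\mathcal{O}(V)\otimes\mathrm{Hom}(E,F)$ are regarded as $\mathcal{O}(V)$-linear maps $\mathcal{O}(V)\otimes E\to\mathcal{O}(V)\otimes F$ by $(\omega\otimes\phi)(\eta\otimes e)=(-1)^{|\phi||\eta|}\omega\odot\eta\otimes\phi(e)$; $[-,-]$ is the graded commutator; the Koszul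 sign rule is used throughout. $L_\infty[1]$-algebras. An $L_\infty[1]$-algebra (SH Lie algebra) is a graded vector space $L$ with degree $1$ maps $\lambda_k:S^k(L)\to L$, $k\ge 0$, such that for all $n\geq 0$, $\sum_{k+l=n}\sum_{\sigma\in \mathrm{sh}(l,k)}\epsilon(\sigma)\lambda_{k+1}(\lambda_l(u_{\sigma(1)},\dots,u_{\sigma(l)}),u_{\sigma(l+1)},\dots,u_{\sigma(n)})=0$ ($\mathrm{sh}(l,k)$: $(l,k)$-unshuffles, $\epsilon(\sigma)$: Koszul sign). Equivalently it is a degree $1$ derivation $Q_L$ of $\mathcal{O}(L)$ with $Q_L^2=0$, the relation being $\langle\xi,\lambda_k(u_1,\dots,u_k)\rangle=(-1)^{|\xi|+k}\langle Q_L(\xi),u_1\odot\cdots\odot u_k\rangle$ for $\xi\in L^\vee$; here, for $x\in S^k(L^\vee)$, $\langle x,u_1\odot\cdots\odot u_k\rangle=x\llcorner u_1\cdots\llcorner u_k$ with $\llcorner u$ given by $\xi\llcorner u=\xi(u)$ and $(\xi\odot\eta)\llcorner u=(-1)^{|u||\eta|}(\xi\llcorner u)\odot\eta+\xi\odot(\eta\llcorner u)$ (only the $S^k$-component of $Q_L(\xi)$ contributes). SH Lie pairs. An SH Lie pair $(L,A)$ is an $L_\infty[1]$-algebra $L$ with a subalgebra $A\subset L$, i.e. a graded subspace with $\lambda_k(A,\dots,A)\subset A$ for all $k\ge0$. Let $j:A\to L$ be the inclusion and $j^\vee:\mathcal{O}(L)\to\mathcal{O}(A)$ the restriction; $Q_A$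 is the homological vector field of $A$, so $j^\vee\circ Q_L=Q_A\circ j^\vee$. Put $A^\perp=\ker(j^\vee:L^\vee\to A^\vee)\cong B^\vee$. Let $I^V:\mathcal{O}(V)\to\mathcal{O}(V)\otimes V^\vee$ be given by $I^V(1)=0$, $I^V(\xi)=1\otimes\xi$ for $\xi\in V^\vee$, $I^V(\omega\odot\omega')=\omega\odot I^V(\omega')+(-1)^{|\omega||\omega'|}\omega'\odot I^V(\omega)$, and $J=(j^\vee\otimes 1)\circ I^L:\mathcal{O}(L)\to\mathcal{O}(A)\otimes L^\vee$. Modules. An $A$-module is a graded vector space $E$ with $D^{A,E}\in(\mathcal{O}(A)\otimes\mathrm{End}(E))^1$ such that $\partial_A^E=Q_A+D^{A,E}$, i.e. $\partial_A^E(\omega\otimes e)=Q_A(\omega)\otimes e+(-1)^{|\omega|}\omega\odot D^{A,E}(e)$, satisfies $(\partial_A^E)^2=0$; $\mathrm{H}^\bullet_{\mathrm{CE}}(A,E)=\mathrm{H}^\bullet(\mathcal{O}(A)\otimes E,\partial_A^E)$. The canonical $A$-module structure on $B=L/A$ is the one induced by $m_k(a_1,\dots,a_{k-1},p(l))=p(\lambda_k(a_1,\dots,a_{k-1},l))$, $p:L\to B$ the projection; its dual on $A^\perp\cong B^\vee$ is $\partial_A^\perp=Q_A+D^\perp$ with $D^\perp(\xi)=J(Q_L(\xi))$ for $\xi\in A^\perp$, and $\partial_A^B$ is determined by $\langle\partial_A^\perp f,g\rangle=Q_A\langle f,g\rangle-(-1)^{|f|}\langle f,\partial_A^Bg\rangle$.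 $B[-2]$ carries the same differential. On $A^\perp\otimes\mathrm{End}(E)$ the differential is $Q_A+D^\perp+[D^{A,E},-]$. Atiyah cocycle and operator. An $L$-connection on $E$ extending $(A,E)$ is $\nabla=Q_L+D^{L,E}$ with $D^{L,E}\in(\mathcal{O}(L)\otimes\mathrm{End}(E))^1$, $(j^\vee\otimes1)(D^{L,E})=D^{A,E}$. Its curvature is $R^\nabla=Q_L(D^{L,E})+(D^{L,E})^2$, and the Atiyah cocycle is the degree $2$ cocycle $\alpha^E=(J\otimes1)(R^\nabla)\in\mathcal{O}(A)\otimes B^\vee\otimes\mathrm{End}(E)\cong\mathcal{O}(A)\otimes\mathrm{Hom}(B\otimes E,E)$, whose cohomology class does not depend on the choice of $\nabla$. The Atiyah operator is $\bm{\alpha}^E(x)r=\alpha^E(x\otimes_{\mathcal{O}(A)}r)\in\mathcal{O}(A)\otimes E$ for $x\in\mathcal{O}(A)\otimes B$, $r\in\mathcal{O}(A)\otimes E$ (apply the $\mathcal{O}(A)$-linear extension of $\alpha^E$ in $\mathcal{O}(A)\otimes\mathrm{Hom}(B\otimes E,E)$). Viewed with $B$ replaced by $B[-2]$, the operators $\bm{\alpha}^B$ and $\bm{\alpha}^E$ have degree $0$. Lie algebra and module are in the graded sense: $[x,y]=-(-1)^{|x||y|}[y,x]$, the graded Jacobi identity holds, and $x\triangleright(y\triangleright r)-(-1)^{|x||y|}y\triangleright(x\triangleright r)=[x,y]\triangleright r$. *)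

(* Defs.v *)
From HB Require Import structures.
From mathcomp Require Import all_boot all_order all_fingroup all_algebra.
From mathcomp Require Import ring_quotient generic_quotient.
From mathcomp Require Import boolp functions.

Set Implicit Arguments.
Unset Strict Implicit.
Unset Printing Implicit Defensive.

Import GRing.Theory.
Local Open Scope ring_scope.

(* A decomposition V = \bigoplus_n V^n, given by the projections
   [pr n : V -> V^n]; [supp] lists finitely many degrees outside of which
   V^n = 0. *)
Record gvect (K : fieldType) := GVect {
  gv_sort :> vectType K;
  pr : int -> 'End(gv_sort);
  supp : seq int;
  supp_uniq : uniq supp;
  pr_pr : forall m n v, pr m (pr n v) = if m == n then pr n v else 0;
  pr_sum : forall v, \sum_(n <- supp) pr n v = v }.

Arguments pr {K} V n : rename.
Arguments supp {K} V : rename.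

Section GradedSpaces.
Variable K : fieldType.
Implicit Types V W : gvect K.

Definition homog V (n : int) (v : V) : bool := pr V n v == v.

(* (-1)^(n |v|) v, extended linearly to all v *)
Definition kos V (n : int) (v : V) : V :=
  \sum_(m <- supp V) ((-1) ^ (n * m) : K) *: pr V m v.

Lemma pr_supp V n v : n \notin supp V -> pr V n v = 0.
Proof.
move=> nV; rewrite -[v]pr_sum raddf_sum big_seq big1 // => m mV.
by rewrite /= pr_pr; case: eqP => // nm; rewrite nm mV in nV.
Qed.

Lemma pr_sum_uniq V (s : seq int) v :
  uniq s -> {subset supp V <= s} -> \sum_(n <- s) pr V n v = v.
Proof.
move=> us sub; rewrite -[RHS]pr_sum (bigID (mem (supp V))) /= addrC big1; last first.
  by move=> n nV; apply: pr_supp.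
rewrite add0r -big_filter; apply: perm_big; apply: uniq_perm.
- exact: filter_uniq.
- exact: supp_uniq.
by move=> n; rewrite mem_filter; apply/andP/idP => [[]//|nV]; split=> //; apply: sub.
Qed.

(* V[k]^n = V^(n+k) *)
Section Shift.
Variables (V : gvect K) (k : int).
Let shift_pr (n : int) : 'End(V) := pr V (n + k).
Let shift_supp := [seq n - k | n <- supp V].
Fact shift_supp_uniq : uniq shift_supp.
Proof. by rewrite map_inj_uniq ?supp_uniq // => m n /addIr. Qed.
Fact shift_pr_pr m n v :
  shift_pr m (shift_pr n v) = if m == n then shift_pr n v else 0.
Proof. by rewrite /shift_pr pr_pr (inj_eq (addIr k)). Qed.
Fact shift_pr_sum v : \sum_(n <- shift_supp) shift_pr n v = v.
Proof.
rewrite big_map -[RHS]pr_sum; apply: eq_bigr => n _.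
by rewrite /shift_pr subrK.
Qed.
Definition shiftG := GVect shift_supp_uniq shift_pr_pr shift_pr_sum.
End Shift.

(* Hom(V, W)^k = {phi | phi V^n <= W^(n+k) for all n} *)
Section Hom.
Variables V W : gvect K.
Let hp (k : int) (phi : 'Hom(V, W)) : 'Hom(V, W) :=
  \sum_(n <- supp V) (pr W (n + k) \o phi \o pr V n)%VF.
Fact hom_pr_linear k : linear (hp k).
Proof.
move=> a f g; rewrite /hp scaler_sumr -big_split /=; apply: eq_bigr => n _.
by apply/lfunP => v; rewrite !(comp_lfunE, add_lfunE, scale_lfunE) linearP.
Qed.
HB.instance Definition _ k := @GRing.isLinear.Build K _ _ _ (hp k) (hom_pr_linear k).
Let hom_pr (k : int) : 'End('Hom(V, W)) := linfun (hp k).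
Let hom_supp := undup [seq m - n | m <- supp W, n <- supp V].
Fact hom_supp_uniq : uniq hom_supp. Proof. exact: undup_uniq. Qed.

Lemma hpE k phi v : hp k phi v = \sum_(n <- supp V) pr W (n + k) (phi (pr V n v)).
Proof.
by rewrite /hp sum_lfunE; apply: eq_bigr => n _; rewrite !comp_lfunE.
Qed.

Lemma hp_pr k phi n v : hp k phi (pr V n v) = pr W (n + k) (phi (pr V n v)).
Proof.
rewrite hpE; have [nV|nV] := boolP (n \in supp V); last first.
  by rewrite pr_supp // !linear0 big1 // => i _; rewrite !linear0.
rewrite (bigD1_seq n) ?supp_uniq //= pr_pr eqxx big1 ?addr0 // => m /negPf mn.
by rewrite pr_pr mn !linear0.
Qed.

Fact hom_pr_pr m n phi :
  hom_pr m (hom_pr n phi) = if m == n then hom_pr n phi else 0.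
Proof.
rewrite !lfunE /=; apply/lfunP => v; rewrite hpE.
under eq_bigr => i _ do rewrite hp_pr pr_pr (inj_eq (addrI i)).
case: eqP => _; first by rewrite hpE.
by rewrite big1 // lfunE.
Qed.

Fact hom_pr_sum phi : \sum_(k <- hom_supp) hom_pr k phi = phi.
Proof.
apply/lfunP => v; rewrite sum_lfunE -{2}[v]pr_sum raddf_sum /=.
under eq_bigr => k _ do rewrite lfunE /= hpE.
rewrite exchange_big /= big_seq [RHS]big_seq; apply: eq_bigr => n nV.
rewrite -(big_map (fun k => n + k) predT (fun k => pr W k (phi (pr V n v)))).
apply: pr_sum_uniq => [|m mW].
  by rewrite map_inj_uniq ?undup_uniq //; apply: addrI.
apply/mapP; exists (m - n); last by rewrite addrC subrK.
by rewrite mem_undup; apply/allpairsP; exists (m, n).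
Qed.
Definition homG := GVect hom_supp_uniq hom_pr_pr hom_pr_sum.
End Hom.

(* The vector space V/A is modelled on the complement A^C, onto which [quo]
   projects along A (see [quo_eq0]); the grading is the one for which [quo] has
   degree 0. *)
Section SubQuotient.
Variables (V : gvect K) (A : {vspace V}).
Hypothesis grA : forall n, (pr V n @: A <= A)%VS.

Let sub_pr (n : int) : 'End(subvs_of A) :=
  linfun (fun a => vsproj A (pr V n (vsval a))).
Let sub_prE n a : sub_pr n a = vsproj A (pr V n (vsval a)).
Proof. by rewrite (lfunE (vsproj A \o pr V n \o @vsval _ _ A)). Qed.
Let pr_in n (a : subvs_of A) : pr V n (vsval a) \in A.
Proof. by apply: (subvP (grA n)); apply: memv_img; apply: subvsP. Qed.
Fact sub_pr_pr m n a : sub_pr m (sub_pr n a) = if m == n then sub_pr n a else 0.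
Proof.
rewrite !sub_prE vsprojK // pr_pr; case: eqP => // _; exact: linear0.
Qed.
Fact sub_pr_sum a : \sum_(n <- supp V) sub_pr n a = a.
Proof.
under eq_bigr => n _ do rewrite sub_prE.
by rewrite -linear_sum /= pr_sum vsvalK.
Qed.
Definition subG := GVect (supp_uniq V) sub_pr_pr sub_pr_sum.

Definition quo (v : V) : subvs_of A^C := vsproj A^C (daddv_pi A^C A v).
Fact quo_linear : linear quo.
Proof. by move=> a u v; rewrite /quo !linearP. Qed.
HB.instance Definition _ := @GRing.isLinear.Build K _ _ _ quo quo_linear.

Let dAC : (A^C :&: A = 0)%VS. Proof. by rewrite capvC capv_compl. Qed.

Lemma quo_val b : quo (vsval b) = b.
Proof. by rewrite /quo daddv_pi_id ?vsvalK ?dAC // subvsP. Qed.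

Lemma quo_sub_val v : v - vsval (quo v) \in A.
Proof.
rewrite /quo vsprojK ?memv_pi //.
have vAC : v \in (A^C + A)%VS by rewrite addvC addv_complf memvf.
by rewrite -{1}(daddv_pi_add dAC vAC) addrC addKr memv_pi.
Qed.

Lemma quo_eq0 v : (quo v == 0) = (v \in A).
Proof.
apply/eqP/idP => [q0|vA]; first by have := quo_sub_val v; rewrite q0 (linear0 (@vsval _ _ A^C)) subr0.
have vq : vsval (quo v) \in (A^C :&: A)%VS.
  rewrite memv_cap subvsP -(subKr v (vsval _)) rpredB //; exact: quo_sub_val.
by move: vq; rewrite dAC memv0 => /eqP vq; apply: subvs_inj; rewrite vq (linear0 (@vsval _ _ A^C)).
Qed.

Let quo_pr (n : int) : 'End(subvs_of A^C) :=
  linfun (fun b => quo (pr V n (vsval b))).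
Let quo_prE n b : quo_pr n b = quo (pr V n (vsval b)).
Proof. by rewrite (lfunE (quo \o pr V n \o @vsval _ _ A^C)). Qed.

Lemma quo_pr_quo n v : quo_pr n (quo v) = quo (pr V n v).
Proof.
rewrite quo_prE; apply/eqP; rewrite -subr_eq0 -linearB quo_eq0 -linearB.
apply: (subvP (grA n)); apply: memv_img.
by rewrite -opprB rpredN quo_sub_val.
Qed.

Fact quo_pr_pr m n b : quo_pr m (quo_pr n b) = if m == n then quo_pr n b else 0.
Proof.
rewrite [quo_pr n b]quo_prE quo_pr_quo pr_pr; case: eqP => // _.
exact: linear0.
Qed.
Fact quo_pr_sum b : \sum_(n <- supp V) quo_pr n b = b.
Proof.
under eq_bigr => n _ do rewrite quo_prE.
by rewrite -linear_sum /= pr_sum quo_val.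
Qed.
Definition quoG := GVect (supp_uniq V) quo_pr_pr quo_pr_sum.
End SubQuotient.

End GradedSpaces.

(* The cohomology of the complex C <= U with the differential d.  Neither
   d C <= C nor d^2 = 0 is required: in general this is
   {c in C | d c = 0} / {c in C | d c = 0, c in d(C)}. *)
Section Cohomology.
Variables (K : fieldType) (U : lmodType K) (C : submodClosed U).
Variable d : {linear U -> U}.

Definition cocycle : {pred U} := [pred c | (c \in C) && (d c == 0)].

Fact cocycle_submod : submod_closed cocycle.
Proof.
split=> [|a u v]; first by rewrite inE rpred0 linear0 eqxx.
rewrite !inE => /andP[uC /eqP du] /andP[vC /eqP dv].
by rewrite rpredD ?rpredZ //= linearP du dv scaler0 addr0 eqxx.
Qed.
HB.instance Definition _ := GRing.isSubmodClosed.Build K U cocycle cocycle_submod.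

Record cocycles := Cocycle { cocycle_val : U; _ : cocycle_val \in cocycle }.
HB.instance Definition _ := [isSub for cocycle_val].
HB.instance Definition _ := [Choice of cocycles by <:].
HB.instance Definition _ := [SubChoice_isSubLmodule of cocycles by <:].

Definition exact : {pred cocycles} :=
  [pred z : cocycles | `[< exists2 y, y \in C & d y = cocycle_val z >]].

Fact exact_submod : submod_closed exact.
Proof.
split=> [|a u v]; first by apply/asboolP; exists 0; rewrite ?rpred0 ?linear0.
move=> /asboolP[x xC dx] /asboolP[y yC dy]; apply/asboolP.
by exists (a *: x + y); rewrite ?rpredD ?rpredZ // linearP dx dy.
Qed.
HB.instance Definition _ := GRing.isSubmodClosed.Build K cocycles exact exact_submod.

Definition cohomology := Quotient.quot exact.
HB.instance Definition _ := GRing.Zmodule.on cohomology.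
HB.instance Definition _ := EqQuotient.on cohomology.

Let piE (x y : cocycles) :
  (\pi_cohomology x == \pi_cohomology y)%qT = (x - y \in exact).
Proof. by rewrite -Quotient.idealrBE. Qed.
Let piD (x y : cocycles) :
  (\pi_cohomology (x + y) = \pi_cohomology x + \pi_cohomology y)%qT.
Proof. exact: (raddfD (\pi_(Quotient.quot exact))%qT). Qed.

Definition coh_scale (a : K) (h : cohomology) : cohomology :=
  (\pi_cohomology (a *: repr h : cocycles))%qT.

Let pi_scale a (x : cocycles) :
  coh_scale a (\pi_cohomology x)%qT = (\pi_cohomology (a *: x))%qT.
Proof.
apply/eqP; rewrite piE -scalerBr rpredZ // -piE; apply/eqP.
by rewrite reprK.
Qed.

Fact coh_scaleA a b h : coh_scale a (coh_scale b h) = coh_scale (a * b) h.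
Proof.
by move: (repr h) (reprK h) => x <-; rewrite [coh_scale b _]pi_scale !pi_scale scalerA.
Qed.
Fact coh_scale1 : left_id 1 coh_scale.
Proof.
by move=> h; move: (repr h) (reprK h) => x <-; rewrite pi_scale scale1r.
Qed.
Fact coh_scaleDr : right_distributive coh_scale +%R.
Proof.
move=> a g h; move: (repr g) (reprK g) => x <-.
by move: (repr h) (reprK h) => y <-; rewrite -piD !pi_scale -piD scalerDr.
Qed.
Fact coh_scaleDl h : {morph coh_scale^~ h : a b / a + b}.
Proof.
move=> a b; move: (repr h) (reprK h) => x <-.
by rewrite !pi_scale -piD scalerDl.
Qed.
HB.instance Definition _ := GRing.Zmodule_isLmodule.Build K cohomology
  coh_scaleA coh_scale1 coh_scaleDr coh_scaleDl.

(* The class of a cocycle (and 0 for the other elements of U). *)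
Definition cls (c : U) : cohomology :=
  (\pi_cohomology (insubd (0 : cocycles) c))%qT.

Lemma cls_surj h : exists2 c, c \in cocycle & h = cls c.
Proof.
exists (val (repr h)); first exact: valP.
by rewrite /cls valKd reprK.
Qed.

Lemma cls_eq c c' : c \in cocycle -> c' \in cocycle ->
  cls c = cls c' <-> exists2 y, y \in C & d y = c - c'.
Proof.
move=> Zc Zc'; have -> : (cls c = cls c') <-> cls c == cls c' by split=> /eqP.
have valE : cocycle_val (insubd (0 : cocycles) c - insubd 0 c') = c - c'.
  by rewrite -[cocycle_val]/(val : cocycles -> U) raddfB /= !insubdK.
by rewrite piE -valE; split=> /asboolP.
Qed.

Lemma cls_linear a c c' : c \in cocycle -> c' \in cocycle ->
  cls (a *: c + c') = a *: cls c + cls c'.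
Proof.
move=> Zc Zc'; rewrite [a *: cls c]pi_scale -piD; congr (\pi _)%qT.
by apply: val_inj; rewrite /= !insubdK // rpredD ?rpredZ.
Qed.

End Cohomology.

Section Unshuffles.
Variable K : fieldType.

(* (l, n - l)-unshuffles: increasing on [0, l) and on [l, n) *)
Definition unshuffle (n l : nat) (s : 'S_n) : bool :=
  [forall i : 'I_n, forall j : 'I_n,
    (i < j)%N && ((j < l) || (l <= i))%N ==> (s i < s j)%N].

(* The sign of u_0 ... u_{n-1} |-> u_{s 0} ... u_{s (n-1)}, |u_i| = d i *)
Definition koszul (n : nat) (d : 'I_n -> int) (s : 'S_n) : K :=
  \prod_(i < n) \prod_(j < n | (i < j)%N && (s j < s i)%N)
    (-1) ^ (d (s i) * d (s j)).

(* [ush g u] = \sum_l \sum_(s in sh(l, n-l)) epsilon(s)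
                 g [u_(s 0); ..; u_(s (l-1))] [u_(s l); ..; u_(s (n-1))],
   extended multilinearly to arguments that are not homogeneous: the head of u
   goes either to the first block, or to the second one, and in the latter
   case it has to move past the rest of the first block. *)
Fixpoint ush (V : gvect K) (W : lmodType K) (g : seq V -> seq V -> W)
    (u : seq V) : W :=
  if u is x :: u' then
    ush (fun a b => g (x :: a) b) u' +
    \sum_(n <- supp V) ush (fun a b => g (map (@kos _ V n) a) (pr V n x :: b)) u'
  else g [::] [::].

Lemma ush_linear (V : gvect K) (W : lmodType K) (c : K)
    (g g1 g2 : seq V -> seq V -> W) u :
  (forall a b, g a b = c *: g1 a b + g2 a b) ->
  ush g u = c *: ush g1 u + ush g2 u.
Proof.
elim: u => [|x u IHu] in g g1 g2 * => gE /=; first exact: gE.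
rewrite (IHu _ (fun a b => g1 (x :: a) b) (fun a b => g2 (x :: a) b)) //.
rewrite scalerDr addrACA; congr (_ + _).
rewrite scaler_sumr -big_split /=; apply: eq_bigr => n _.
by apply: IHu => a b; apply: gE.
Qed.

End Unshuffles.

(* O(V) (x) W is represented by families, indexed by the length of the
   argument, of graded symmetric multilinear maps f from V to W: writing
   x |_ u for the right contraction, omega (x) w stands for
     [:: u_1; ..; u_k] |-> (omega |_ u_1 .. |_ u_k) w      (no sign),
   which identifies S^k(V^v) with the graded symmetric k-linear forms (K has
   characteristic 0).  No condition relates different lengths: this is the
   product over k of the S^k(V^v) (x) W. *)
Section Series.
Variable K : fieldType.
Implicit Types V W : gvect K.

Definition multilinear V W (f : seq V -> W) : Prop :=
  forall (s t : seq V) (c : K) (x y : V),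
    f (s ++ (c *: x + y) :: t) = c *: f (s ++ x :: t) + f (s ++ y :: t).

Definition gsymmetric V W (f : seq V -> W) : Prop :=
  forall (s t : seq V) (m n : int) (x y : V), homog m x -> homog n y ->
    f (s ++ x :: y :: t) = ((-1) ^ (m * n) : K) *: f (s ++ y :: x :: t).

(* |omega (x) w| = |omega| + |w|, and omega |_ u_1 .. |_ u_k <> 0 only if
   |omega| = - |u_1| - .. - |u_k|. *)
Definition has_degree V W (d : int) (f : seq V -> W) : Prop :=
  forall (u : seq V) (e : seq int), all2 (@homog K V) e u ->
    homog (d + \sum_(k <- e) k) (f u).

(* elements of (O(V) (x) W)^d *)
Definition hform V W (d : int) (f : seq V -> W) : Prop :=
  [/\ multilinear f, gsymmetric f & has_degree d f].

(* \bigoplus_d (O(V) (x) W)^d *)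
Definition series V W : {pred (seq V -> W)} :=
  [pred f | `[< exists2 F : seq (seq V -> W),
      {in F, forall g, exists d, hform d g} & f = \sum_(g <- F) g >]].

Lemma hformZ V W d (c : K) (f : seq V -> W) : hform d f -> hform d (c *: f).
Proof.
case=> fL fS fd; split=> [s t a x y|s t m n x y hx hy|u e ue].
- rewrite !scalrfctE fL scalerDr !scalerA; congr (_ *: _ + _).
  exact: mulrC.
- by rewrite !scalrfctE (fS _ _ _ _ _ _ hx hy) !scalerA mulrC.
- by rewrite /homog scalrfctE linearZ /= (eqP (fd _ _ ue)).
Qed.

Fact series_submod V W : submod_closed (@series V W).
Proof.
split=> [|c f g]; first by apply/asboolP; exists [::] => //; rewrite big_nil.
move=> /asboolP[F hF ->] /asboolP[G hG ->]; apply/asboolP.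
exists (map (fun h => c *: h) F ++ G); last first.
  by rewrite big_cat big_map -scaler_sumr.
move=> h; rewrite mem_cat => /orP[/mapP[h' hh' ->]|/hG//].
by have [d hd] := hF _ hh'; exists d; apply: hformZ.
Qed.
HB.instance Definition _ V W :=
  GRing.isSubmodClosed.Build K (seq V -> W) (@series V W) (@series_submod V W).

(* The product
     (omega (x) w1) (eta (x) w2)
       = (-1)^(|w1| |eta|) (omega . eta) (x) beta w1 w2
   of O(V) (x) W1 and O(V) (x) W2 along a bilinear map beta.  By
     (omega . eta) |_ u = (-1)^(|u| |eta|) (omega |_ u) . eta
                          + omega . (eta |_ u)
   the value of omega . eta at u is the sum over the unshuffles of u into the
   arguments a of eta followed by the arguments b of omega; and
   |eta| = - |a| where eta does not vanish. *)
Definition sprod V (W1 : gvect K) (W2 W3 : lmodType K) (beta : W1 -> W2 -> W3)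
    (f : seq V -> W1) (g : seq V -> W2) : seq V -> W3 :=
  ush (fun a b =>
    \sum_(k <- supp W1) beta (pr W1 k (f b)) (g (map (@kos _ V k) a))).

(* (omega (x) phi) (eta (x) e) = (-1)^(|phi| |eta|) (omega . eta) (x) phi(e) *)
Definition sapp V (E F : gvect K) (Phi : seq V -> homG E F) (r : seq V -> E) :
    seq V -> F :=
  sprod (fun (phi : homG E F) (e : E) => (phi : 'Hom(E, F)) e) Phi r.

Definition scomp V (E : gvect K) (Phi Psi : seq V -> homG E E) :
    seq V -> homG E E :=
  sprod (fun phi psi : homG E E => ((phi : 'End(E)) \o psi)%VF) Phi Psi.

(* The derivation Q of O(V) with
     <Q xi, u_1 .. u_k> = (-1)^(|xi| + k) <xi, lam_k (u_1, .., u_k)>,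
   tensored with the identity of W:
     (Q f)(u) = (-1)^|f| \sum (-1)^l eps(s) f (lam_l u_(s 0) .. u_(s (l-1)) :: ..)
   the sum being over all unshuffles.  Here |f| is the degree of the O(V)-part
   of f; as lam has degree 1, only |f| = - |u| - 1 contributes, whence the
   overall sign and the twist of u by [kos 1].  For W = K and f = xi in V^v
   only l = k contributes, which is the displayed relation. *)
Definition hvf V (lam : seq V -> V) (W : lmodType K) (f : seq V -> W) :
    seq V -> W :=
  fun u => - ush (fun a b => (-1) ^+ size a *: f (lam a :: b))
                 (map (@kos _ V 1) u).

Definition covd V (lam : seq V -> V) (E : gvect K) (D : seq V -> homG E E)
    (r : seq V -> E) : seq V -> E :=
  hvf lam r + sapp D r.

Fact hvf_linear V lam (W : lmodType K) : linear (@hvf V lam W).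
Proof.
move=> c f g; apply/funext => u; rewrite !fctE /hvf scalerN -opprD.
congr (- _); apply: ush_linear => a b.
by rewrite scalerDr !scalerA mulrC.
Qed.

Fact sapp_linear V (E F : gvect K) (D : seq V -> homG E F) : linear (sapp D).
Proof.
move=> c f g; apply/funext => u; rewrite !fctE.
apply: ush_linear => a b; rewrite scaler_sumr -big_split.
by apply: eq_bigr => k _; rewrite linearP.
Qed.

Fact covd_linear V lam (E : gvect K) D : linear (@covd V lam E D).
Proof.
move=> c r s; rewrite /covd hvf_linear sapp_linear.
by rewrite scalerDr addrACA.
Qed.
HB.instance Definition _ V lam (E : gvect K) D :=
  @GRing.isLinear.Build K _ _ _ (@covd V lam E D) (@covd_linear V lam E D).

End Series.

(* An L_infty[1]-algebra; lambda_k is the restriction of [lam] to lists of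
   length k. *)
Record linfty (K : fieldType) := LInfty {
  linfty_space :> gvect K;
  lam : seq linfty_space -> linfty_space;
  lam_hform : hform 1 lam;
  lam_jacobi : forall (n : nat) (u : 'I_n -> linfty_space) (d : 'I_n -> int),
    (forall i, homog (d i) (u i)) ->
    \sum_(l < n.+1) \sum_(s : 'S_n | unshuffle l s)
      koszul K d s *:
        lam (lam [seq u (s i) | i : 'I_n <- enum 'I_n & (i < l)%N]
               :: [seq u (s i) | i : 'I_n <- enum 'I_n & (l <= i)%N]) = 0 }.

Arguments lam {K} L u : rename.

Record subalg (K : fieldType) (L : linfty K) := SubAlg {
  subalg_space :> {vspace L};
  subalg_graded : forall n, (pr L n @: subalg_space <= subalg_space)%VS;
  subalg_closed : forall s : seq L,
    {subset s <= subalg_space} -> lam L s \in subalg_space }.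

Section SHLiePair.
Variables (K : fieldType) (L : linfty K) (A : subalg L).

Definition subA : gvect K := subG (subalg_graded A).
Definition quoLA : gvect K := quoG (subalg_graded A).

Definition inclA (a : subA) : L := vsval a.
Definition projB (l : L) : quoLA := quo A l.
(* a linear section of [projB], in general not of degree 0 *)
Definition liftB (b : quoLA) : L := vsval b.

Definition lamA (s : seq subA) : subA := vsproj A (lam L (map inclA s)).

(* j^v (x) 1 *)
Definition restrA (W : Type) (f : seq L -> W) : seq subA -> W :=
  fun a => f (map inclA a).

Section Modules.
Variable E : gvect K.

Definition is_module (D : seq subA -> homG E E) : Prop :=
  hform 1 D /\
  {in @series K subA E, forall r, covd lamA D (covd lamA D r) = 0}.

Definition is_connection (DA : seq subA -> homG E E) (DL : seq L -> homG E E) :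
    Prop :=
  hform 1 DL /\ restrA DL = DA.

(* Q_L(D) + D^2 *)
Definition curvature (DL : seq L -> homG E E) : seq L -> homG E E :=
  hvf (lam L) DL + scomp DL DL.

(* As I^L(omega)(u) = omega |_ u, the element J(omega) (x) phi of
   O(A) (x) L^v (x) End(E) is a |-> (omega (l :: a))_l (x) phi, i.e.,
   a |-> (l |-> (-1)^(|phi| |l|) omega(l :: a) phi) as a Hom(L, End(E))-valued
   series.  When DL extends the structure of an A-module this vanishes for l
   in A, hence it is a series with values in
   Hom(L/A, End(E)) = Hom(L/A (x) E, E). *)
Definition atiyah_cocycle (DL : seq L -> homG E E) :
    seq subA -> homG quoLA (homG E E) :=
  fun a => linfun (fun b : quoLA =>
    \sum_(n <- supp L)
      @kos K (homG E E) n (curvature DL (pr L n (liftB b) :: map inclA a))).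

(* alpha (x (x)_O(A) r), with the curried form of alpha: for
   alpha = omega (x) Psi, x = xi (x) b and r = eta (x) e it is
   (-1)^(|Psi| (|xi| + |eta|) + |b| |eta|) (omega . xi . eta) (x) Psi(b, e) *)
Definition atiyah (DL : seq L -> homG E E) (x : seq subA -> quoLA)
    (r : seq subA -> E) : seq subA -> E :=
  sapp (sapp (atiyah_cocycle DL) x) r.

End Modules.

(* The canonical A-module structure on L/A:
     D^B(a_1, .., a_n)(p l) = (-1)^n p (lambda_(n+1) (a_1, .., a_n, l)).
   For xi in A^perp, b = p l and k = n + 1,
     J(Q_L xi)(a)(l) = (-1)^(|xi| + k) xi (lambda_k (l, a)),
   and <D^perp xi, b> = - (-1)^|xi| <xi, D^B b> gives the sign. *)
Definition DB : seq subA -> homG quoLA quoLA :=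
  fun a => linfun (fun b : quoLA =>
    (-1) ^+ size a *: projB (lam L (rcons (map inclA a) (liftB b)))).

End SHLiePair.

Definition dCE (K : fieldType) (L : linfty K) (A : subalg L) (E : gvect K)
    (D : seq (subA A) -> homG E E) :
    {linear (seq (subA A) -> E) -> (seq (subA A) -> E)} :=
  covd (lamA (A := A)) D.

(* [HCE d] is the total cohomology \bigoplus_n H^n(O(V) (x) W, d), and
   [degCE n] is its summand H^n. *)
Definition cocycleCE (K : fieldType) (V W : gvect K)
    (d : {linear (seq V -> W) -> (seq V -> W)}) : {pred (seq V -> W)} :=
  cocycle (@series K V W) d.

Definition HCE (K : fieldType) (V W : gvect K)
    (d : {linear (seq V -> W) -> (seq V -> W)}) : lmodType K :=
  cohomology (@series K V W) d.

Definition clsCE (K : fieldType) (V W : gvect K)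
    (d : {linear (seq V -> W) -> (seq V -> W)}) (c : seq V -> W) : HCE d :=
  cls (@series K V W) d c.

Definition degCE (K : fieldType) (V W : gvect K)
    (d : {linear (seq V -> W) -> (seq V -> W)}) (n : int) (h : HCE d) : Prop :=
  exists c, [/\ hform n c, c \in cocycleCE d & h = clsCE d c].

Section GradedLie.
Variables (K : fieldType) (H M : lmodType K).
Variables (degH : int -> H -> Prop) (degM : int -> M -> Prop).

Definition bilinear_op (M1 M2 M3 : lmodType K) (op : M1 -> M2 -> M3) : Prop :=
  (forall x, linear (op x)) /\ (forall y, linear (op^~ y)).

Definition graded_lie (br : H -> H -> H) : Prop :=
  [/\ bilinear_op br,
      forall m n x y, degH m x -> degH n y -> degH (m + n) (br x y),
      forall m n x y, degH m x -> degH n y ->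
        br x y = - (((-1) ^ (m * n) : K) *: br y x)
    & forall m n p x y z, degH m x -> degH n y -> degH p z ->
        br x (br y z) = br (br x y) z + ((-1) ^ (m * n) : K) *: br y (br x z)].

Definition graded_lie_module (br : H -> H -> H) (act : H -> M -> M) : Prop :=
  [/\ bilinear_op act,
      forall m n x r, degH m x -> degM n r -> degM (m + n) (act x r)
    & forall m n p x y r, degH m x -> degH n y -> degM p r ->
        act x (act y r) - ((-1) ^ (m * n) : K) *: act y (act x r)
          = act (br x y) r].

End GradedLie.

(* Main.v *)
Require Import Defs.
From HB Require Import structures.
From mathcomp Require Import all_boot all_order all_fingroup all_algebra.
From mathcomp Require Import boolp functions ring zify ssrAC.

Set Implicit Arguments.
Unset Strict Implicit.
Unset Printing Implicit Defensive.

Import GRing.Theory.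
Local Open Scope ring_scope.

(** For cocycles x and r the series alpha^E(x) r is exact, so that the bracket
    and the action vanish in cohomology and their identities hold trivially.
    To see this, extend x to a vector field X on L with values in a complement
    of A, extend r to a series r~ on L with X r~ = 0, and put G = nabla r~.  As
    r is a cocycle, G vanishes on A; as x is a cocycle, [Q_L, X] is tangent to
    A.  Hence ([nabla, X] G)|_A = 0, and
      d ((X G)|_A) = +- (X nabla G)|_A = +- (X (R r~))|_A = +- alpha^E(x) r,
    the last step because R vanishes on A.  That L/A is an A-module, which is
    needed when E = L/A, follows in the same way from [Q_L, [Q_L, X]] = 0.

    All identities between series are proved by induction on the length of the
    arguments: contraction with a homogeneous vector v is a derivation of the
    products and insertions involved ([sprod_cons], [ins_cons]), so that both
    sides satisfy the same recursion. *)

(** Exactness of all the values on cocycles does not contradict a nonzero Atiyah class: the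
    primitive (X nabla r~)|_A differentiates r, so it need not be O(A)-linear in r, and alpha itself
    need not be a coboundary. The obstacle is the bookkeeping of signs. Koszul signs are extended to
    non-homogeneous vectors by sums over [supp], which collapse only on homogeneous arguments. They
    are carried by two twists, [Kl] on values and [Kr] on arguments, which agree up to a constant on
    series of a fixed degree; what is left in the end is the parity of an exponent. The factor
    (-1)^k between lambda_k and Q_L is absorbed into mu = [twist (lam L)]; then Q_L is, up to a
    twist, insertion of mu, and the Jacobi identity reads mu o mu = 0. Insertion is not associative,
    but the graded symmetry of its associator is enough to compute commutators of derivations. As
    [liftB] does not respect degrees, X is built from a graded section [glift]; passing from one
    section to the other is harmless because R vanishes on A. *)

Section FunE.
Variables (K : fieldType) (T : Type) (W : lmodType K).
Implicit Types f g : T -> W.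
Lemma addfE f g x : (f + g) x = f x + g x. Proof. by []. Qed.
Lemma oppfE f x : (- f) x = - f x. Proof. by []. Qed.
Lemma scalefE (c : K) f x : (c *: f) x = c *: f x. Proof. by []. Qed.
Lemma zerofE x : (0 : T -> W) x = 0. Proof. by []. Qed.
End FunE.

(** * Signs and parity of exponents *)

Section Signs.
Variable K : fieldType.

Definition sg (n : int) : K := (-1) ^ n.

Lemma sgE n : (-1) ^ n = sg n. Proof. by []. Qed.

Lemma sgD m n : sg (m + n) = sg m * sg n.
Proof. by rewrite /sg expfzDr // oppr_eq0 oner_eq0. Qed.

Lemma sgK n : sg n * sg n = 1.
Proof. by rewrite /sg -expfzMl mulrNN mulr1 exp1rz. Qed.

Lemma sg0 : sg 0 = 1. Proof. exact: expr0z. Qed.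
Lemma sg1 : sg 1 = -1. Proof. exact: expr1z. Qed.

Lemma sgN n : sg (- n) = sg n.
Proof. by rewrite -[LHS]mulr1 -(sgK n) mulrA -sgD addNr sg0 mul1r. Qed.

Lemma sg_even m : sg (m + m) = 1. Proof. by rewrite sgD sgK. Qed.

(** Sign comparisons name the even excess [k + k] and leave the remaining identity of integers to
    [ring]. *)
Lemma sg_par m n k : m = n + (k + k) -> sg m = sg n.
Proof. by move=> ->; rewrite sgD sg_even mulr1. Qed.

(** A square has the parity of its root. *)
Lemma sg_sq m : sg (m * m) = sg m.
Proof.
have sg_nat (k : nat) : sg (k%:Z * k%:Z) = sg k.
  by rewrite /sg -PoszM -!exprnP -signr_odd oddM andbb signr_odd.
by case: (intP m) => // k; rewrite ?mulrNN ?sgN.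
Qed.
End Signs.

(** * Homogeneous vectors and graded symmetric multilinear maps *)

Section Graded.
Variable K : fieldType.
Implicit Types V W : gvect K.

Local Notation sg := (@sg K).

Lemma linear_fun0 (U W : lmodType K) (f : U -> W) : linear f -> f 0 = 0.
Proof. by move=> fL; have := fL (-1) 0 0; rewrite scaler0 addr0 scaleN1r addNr. Qed.

Lemma linear_funD (U W : lmodType K) (f : U -> W) :
  linear f -> {morph f : x y / x + y}.
Proof. by move=> fL x y; have := fL 1 x y; rewrite !scale1r. Qed.

Lemma linear_funZ (U W : lmodType K) (f : U -> W) :
  linear f -> forall c, {morph f : x / c *: x}.
Proof. by move=> fL c x; have := fL c x 0; rewrite !addr0 (linear_fun0 fL) addr0. Qed.

Lemma linear_funN (U W : lmodType K) (f : U -> W) :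
  linear f -> {morph f : x / - x}.
Proof. by move=> fL x; rewrite -scaleN1r (linear_funZ fL) scaleN1r. Qed.

Lemma linear_fun_sum (U W : lmodType K) (f : U -> W) (I : Type) (r : seq I)
    (P : pred I) (F : I -> U) :
  linear f -> f (\sum_(i <- r | P i) F i) = \sum_(i <- r | P i) f (F i).
Proof.
by move=> fL; apply: big_morph; [apply: linear_funD | apply: linear_fun0].
Qed.

Lemma linear_pr V (W : lmodType K) (f : V -> W) v :
  linear f -> f v = \sum_(n <- supp V) f (pr V n v).
Proof. by move=> fL; rewrite -{1}[v]pr_sum (linear_fun_sum _ _ _ fL). Qed.

Lemma linear_ext V (W : lmodType K) (f g : V -> W) :
  linear f -> linear g -> (forall n v, homog n v -> f v = g v) -> f =1 g.
Proof.
move=> fL gL fg v; rewrite (linear_pr _ fL) (linear_pr _ gL).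
by apply: eq_bigr => n _; apply: (fg n); rewrite /homog pr_pr eqxx.
Qed.

Lemma homog_pr V n v : homog n (pr V n v).
Proof. by rewrite /homog pr_pr eqxx. Qed.

Lemma homog0 V n : homog n (0 : V). Proof. by rewrite /homog linear0. Qed.

Lemma homogD V n (v w : V) : homog n v -> homog n w -> homog n (v + w).
Proof. by move=> /eqP hv /eqP hw; rewrite /homog linearD /= hv hw. Qed.

Lemma homogZ V n c (v : V) : homog n v -> homog n (c *: v).
Proof. by move=> /eqP hv; rewrite /homog linearZ /= hv. Qed.

Lemma pr_homog V m n (v : V) : homog n v -> pr V m v = if m == n then v else 0.
Proof. by move=> /eqP hv; rewrite -hv pr_pr. Qed.

Lemma homog_supp V n (v : V) : homog n v -> n \notin supp V -> v = 0.
Proof. by move=> /eqP <- ; apply: pr_supp. Qed.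

(** Collapses the sums over [supp] by which sign conventions are extended to all vectors. If [n] is
    outside [supp V] then [v = 0], which is why [F m 0 = 0] is asked for. *)
Lemma sum_homog V (W : lmodType K) n (v : V) (F : int -> V -> W) :
  (forall m, F m 0 = 0) -> homog n v ->
  \sum_(m <- supp V) F m (pr V m v) = F n v.
Proof.
move=> F0 hv; have [nV|nV] := boolP (n \in supp V); last first.
  rewrite (homog_supp hv nV) F0 big1 // => i _; by rewrite linear0 F0.
rewrite (bigD1_seq n) ?supp_uniq //= (pr_homog _ hv) eqxx big1 ?addr0 //.
by move=> m /negPf mn; rewrite (pr_homog _ hv) mn F0.
Qed.

Fact kos_linear V n : linear (@kos K V n).
Proof.
move=> c v w; rewrite /kos scaler_sumr -big_split; apply: eq_bigr => m _ /=.
by rewrite linearP scalerDr !scalerA mulrC.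
Qed.
HB.instance Definition _ V n :=
  GRing.isLinear.Build K V V _ (@kos K V n) (@kos_linear V n).

Lemma kos_homog V m n (v : V) : homog m v -> kos n v = sg (n * m) *: v.
Proof.
move=> hv; apply: (sum_homog (F := fun k w => sg (n * k) *: w)) hv => k.
exact: scaler0.
Qed.

Lemma homog_kos V m n (v : V) : homog m v -> homog m (kos n v).
Proof. by move=> hv; rewrite (kos_homog n hv) homogZ. Qed.

Lemma kosD V m n (v : V) : kos m (kos n v) = kos (m + n) v.
Proof.
move: v; apply: linear_ext => [c v w|c v w|k v hv]; rewrite ?linearP //.
by rewrite (kos_homog _ (homog_kos _ hv)) !(kos_homog _ hv) scalerA -sgD mulrDl.
Qed.

Lemma kosC V m n (v : V) : kos m (kos n v) = kos n (kos m v).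
Proof. by rewrite !kosD addrC. Qed.

Lemma kosK V n (v : V) : kos n (kos n v) = v.
Proof.
move: v; apply: linear_ext => [c v w|c v w|k v hv]; rewrite ?linearP //.
by rewrite kosD (kos_homog _ hv) mulrDl sg_even scale1r.
Qed.

Lemma pr_kos V m n (v : V) : pr V m (kos n v) = kos n (pr V m v).
Proof.
move: v; apply: linear_ext => [c v w|c v w|k v hv]; rewrite ?linearP //=.
rewrite (kos_homog _ hv) linearZ /= (pr_homog _ hv); case: eqP => _.
  by rewrite (kos_homog _ hv).
by rewrite scaler0 linear0.
Qed.

Lemma homogP V (W : gvect K) (phi : V -> W) : linear phi ->
  (forall n v, phi (pr V n v) = pr W n (phi v)) ->
  forall n v, homog n v -> homog n (phi v).
Proof. by move=> pL pc n v /eqP hv; rewrite /homog -pc hv. Qed.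

Lemma kos_comm V W (phi : V -> W) : linear phi ->
  (forall n v, homog n v -> homog n (phi v)) ->
  forall n v, phi (kos n v) = kos n (phi v).
Proof.
move=> pL hphi n; apply: linear_ext => [c v w|c v w|k v hv].
- by rewrite linearP pL.
- by rewrite pL linearP.
by rewrite (kos_homog _ hv) (linear_funZ pL) (kos_homog _ (hphi _ _ hv)).
Qed.

Definition homogs V (e : seq int) (u : seq V) := all2 (@homog K V) e u.

Lemma homogs_cons V n e (v : V) u :
  homogs (n :: e) (v :: u) = homog n v && homogs e u.
Proof. by []. Qed.

Lemma homogs_kos V e n (u : seq V) : homogs e u -> homogs e (map (@kos K V n) u).
Proof.
elim: u e => [|v u IHu] [|k e] //= /andP[hv hu].
by rewrite homog_kos //= IHu.
Qed.

Lemma map_kosC V m n (u : seq V) :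
  map (@kos K V m) (map (@kos K V n) u) = map (@kos K V n) (map (@kos K V m) u).
Proof. by rewrite -!map_comp; apply: eq_map => v /=; apply: kosC. Qed.

Lemma map_kosK V n (u : seq V) : map (@kos K V n) (map (@kos K V n) u) = u.
Proof. by rewrite -map_comp -[RHS]map_id; apply: eq_map => v /=; apply: kosK. Qed.

Lemma map_kosD V m n (u : seq V) :
  map (@kos K V m) (map (@kos K V n) u) = map (@kos K V (m + n)) u.
Proof. by rewrite -!map_comp; apply: eq_map => v /=; apply: kosD. Qed.

(** The right contraction of [f] by [v]. *)
Definition iot V (W : Type) (v : V) (f : seq V -> W) : seq V -> W := fun u => f (v :: u).

Lemma ml_head V W (f : seq V -> W) u : multilinear f -> linear (fun v => f (v :: u)).
Proof. by move=> fL c v w; apply: (fL [::]). Qed.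

Lemma ml_iot V W (f : seq V -> W) v : multilinear f -> multilinear (iot v f).
Proof. by move=> fL s t c x y; apply: (fL (v :: s)). Qed.

Lemma ml_ext V W (f g : seq V -> W) : multilinear f -> multilinear g ->
  (forall e u, homogs e u -> f u = g u) -> f =1 g.
Proof.
move=> fL gL fg u; elim: u f g fL gL fg => [|v u IHu] f g fL gL fg.
  exact: (fg [::]).
move: v; apply: linear_ext => [||n v hv]; [exact: ml_head | exact: ml_head |].
apply: (IHu (iot v f) (iot v g)) => [||e u' hu]; try exact: ml_iot.
by apply: (fg (n :: e)); rewrite /= /homogs /= hv.
Qed.

Lemma ml_map V V' W (phi : V -> V') (f : seq V' -> W) : linear phi ->
  multilinear f -> multilinear (fun u => f (map phi u)).
Proof. by move=> pL fL s t c x y; rewrite !map_cat /= pL fL. Qed.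

Lemma ml_comp V W W' (psi : W -> W') (f : seq V -> W) : linear psi ->
  multilinear f -> multilinear (fun u => psi (f u)).
Proof. by move=> pL fL s t c x y; rewrite fL pL. Qed.

Lemma ml_lin V W c (f g : seq V -> W) :
  multilinear f -> multilinear g -> multilinear (fun u => c *: f u + g u).
Proof.
move=> fL gL s t d x y; rewrite fL gL !scalerDr !scalerA addrACA mulrC.
by [].
Qed.

(** The Koszul sign sits in [kos n x], so that [x] need not be homogeneous. *)
Lemma gs_swap V W (f : seq V -> W) n v x u : multilinear f -> gsymmetric f ->
  homog n v -> f (x :: v :: u) = f (v :: kos n x :: u).
Proof.
move=> fL fS hv; move: x.
apply: linear_ext => [||m x hx].
- exact: (ml_head (v :: u) fL).
- by move=> c x y; rewrite linearP; apply: (fL [:: v]).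
rewrite (fS [::] _ _ _ _ _ hx hv) (kos_homog _ hx).
by rewrite [RHS](linear_funZ (ml_head u (ml_iot v fL))) mulrC.
Qed.

Lemma gs_iot V W (f : seq V -> W) v : gsymmetric f -> gsymmetric (iot v f).
Proof. by move=> fS s t m n x y hx hy; apply: (fS (v :: s)). Qed.

Lemma hform_iot V W d n (f : seq V -> W) v :
  hform d f -> homog n v -> hform (d + n) (iot v f).
Proof.
move=> [fL fS fd] hv; split; [exact: ml_iot | exact: gs_iot |] => u e hu.
have := fd (v :: u) (n :: e); rewrite /= hv hu => /(_ isT).
by rewrite big_cons addrA.
Qed.

Lemma hform_pull V V' W d (phi : V -> V') (f : seq V' -> W) : linear phi ->
  (forall n v, homog n v -> homog n (phi v)) ->
  hform d f -> hform d (fun u => f (map phi u)).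
Proof.
move=> pL hphi [fL fS fd]; split; first exact: ml_map.
- by move=> s t m n x y hx hy; rewrite !map_cat /= (fS _ _ m n) //; apply: hphi.
move=> u e hu; apply: fd; elim: u e hu => [|v u IHu] [|k e] //= /andP[hv hu].
by rewrite hphi //= IHu.
Qed.

Lemma hform_push V W W' d k (psi : W -> W') (f : seq V -> W) : linear psi ->
  (forall n v, homog n v -> homog (n + k) (psi v)) ->
  hform d f -> hform (d + k) (fun u => psi (f u)).
Proof.
move=> pL hpsi [fL fS fd]; split; first exact: ml_comp.
- by move=> s t m n x y hx hy; rewrite (fS _ _ _ _ _ _ hx hy) (linear_funZ pL).
by move=> u e hu; rewrite addrAC; apply: hpsi; apply: fd.
Qed.

Lemma hform_kosl V W d n (f : seq V -> W) : hform d f -> hform d (kos n \o f).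
Proof.
move=> hf; rewrite -[d]addr0; apply: hform_push hf => [|k v hv].
  exact: kos_linear.
by rewrite addr0 homog_kos.
Qed.

Lemma hform_kosr V W d n (f : seq V -> W) :
  hform d f -> hform d (f \o map (@kos K V n)).
Proof.
by move=> hf; apply: hform_pull hf => [|k v]; [exact: kos_linear | exact: homog_kos].
Qed.

Lemma hform_lin V W d c (f g : seq V -> W) :
  hform d f -> hform d g -> hform d (c *: f + g).
Proof.
move=> [fL fS fd] [gL gS gd]; split; first exact: ml_lin.
- move=> s t m n x y hx hy; rewrite !fctE (fS _ _ _ _ _ _ hx hy) (gS _ _ _ _ _ _ hx hy).
  by rewrite scalerDr !scalerA mulrC.
by move=> u e hu; rewrite homogD ?homogZ //; [apply: fd | apply: gd].
Qed.

Lemma hform0 V W d : hform d (0 : seq V -> W).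
Proof.
split=> [s t c x y|s t m n x y _ _|u e _]; rewrite ?fctE ?scaler0 ?addr0 //.
exact: homog0.
Qed.

Lemma hformD V W d (f g : seq V -> W) : hform d f -> hform d g -> hform d (f + g).
Proof. by move=> hf hg; rewrite -[f]scale1r; apply: hform_lin. Qed.

(** On homogeneous arguments of total degree e the left side acquires the sign of [n * e], whereas
    the value has degree [d + e]. *)
Lemma hform_kos V W d n (f : seq V -> W) u : hform d f ->
  f (map (@kos K V n) u) = sg (n * d) *: kos n (f u).
Proof.
move=> hf; have [fL _ fd] := hf; move: u; apply: ml_ext => [||e u hu].
- by have [] := hform_kosr n hf.
- by have [] := hformZ (sg (n * d)) (hform_kosl n hf).
rewrite (kos_homog _ (fd _ _ hu)) scalerA -sgD mulrDr addrA sgD sg_even mul1r.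
elim: u e f fL hu {hf fd} => [|v u IHu] [|k e] //= f fL.
  by rewrite big_nil mulr0 sg0 scale1r.
move=> /andP[hv hu]; rewrite (kos_homog _ hv) (linear_funZ (ml_head _ fL)).
rewrite -[f (v :: map _ _)]/(iot v f (map _ u)) (IHu e _ (ml_iot v fL) hu).
by rewrite scalerA -sgD -mulrDr big_cons.
Qed.

End Graded.

(** * Sums over unshuffles *)

Section Ush.
Variable K : fieldType.
Implicit Types V W : gvect K.
Local Notation sg := (@sg K).

Lemma eq_ush V (W : lmodType K) (g1 g2 : seq V -> seq V -> W) u :
  (forall a b, g1 a b = g2 a b) -> ush g1 u = ush g2 u.
Proof. by move=> g12; congr (ush _ u); apply/funext => a; apply/funext => b. Qed.

Lemma ushZ V (W : lmodType K) c (g : seq V -> seq V -> W) u :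
  ush (fun a b => c *: g a b) u = c *: ush g u.
Proof.
elim: u g => [|v u IHu] g //=.
rewrite IHu scalerDr scaler_sumr; congr (_ + _).
by apply: eq_bigr => n _; rewrite (IHu (fun a b => g (map (@kos K V n) a) _)).
Qed.

Lemma ushD V (W : lmodType K) (g1 g2 : seq V -> seq V -> W) u :
  ush (fun a b => g1 a b + g2 a b) u = ush g1 u + ush g2 u.
Proof.
by rewrite (@ush_linear _ _ _ 1 _ g1 g2) ?scale1r // => a b; rewrite scale1r.
Qed.

Lemma ush0 V (W : lmodType K) (g : seq V -> seq V -> W) u :
  (forall a b, g a b = 0) -> ush g u = 0.
Proof.
move=> g0; rewrite (@eq_ush _ _ g (fun a b => 0 *: g a b)) => [|a b].
  by rewrite ushZ scale0r.
by rewrite g0 scaler0.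
Qed.

Lemma ush_push V (W W' : lmodType K) (psi : W -> W') (g : seq V -> seq V -> W) u :
  linear psi -> psi (ush g u) = ush (fun a b => psi (g a b)) u.
Proof.
move=> psiL; elim: u g => [|v u IHu] g //=.
rewrite (linear_funD psiL) IHu (linear_fun_sum _ _ _ psiL); congr (_ + _).
by apply: eq_bigr => n _; rewrite IHu.
Qed.

(** Since [ush] runs over the list [supp], the two lists must be the same. They are for [kos n] and
    for the inclusion of A, the maps to which this is applied. *)
Lemma ush_map V V' (W : lmodType K) (phi : V -> V')
    (g : seq V' -> seq V' -> W) u :
  supp V = supp V' -> linear phi ->
  (forall n v, phi (pr V n v) = pr V' n (phi v)) ->
  ush (fun a b => g (map phi a) (map phi b)) u = ush g (map phi u).
Proof.
move=> VV' phiL phipr; have hphi := homogP phiL phipr.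
elim: u g => [|v u IHu] g //=; rewrite -IHu VV'; congr (_ + _).
apply: eq_bigr => n _; rewrite -phipr -IHu; apply: eq_ush => a b.
congr (g _ _); rewrite -!map_comp; apply: eq_map => w /=.
exact: kos_comm.
Qed.

Lemma ush_kos V (W : lmodType K) n (g : seq V -> seq V -> W) u :
  ush g (map (@kos K V n) u) =
  ush (fun a b => g (map (@kos K V n) a) (map (@kos K V n) b)) u.
Proof.
symmetry; apply: ush_map => // [|m v]; first exact: kos_linear.
by rewrite pr_kos.
Qed.

Definition biml V W (g : seq V -> seq V -> W) : Prop :=
  (forall b, multilinear (g^~ b)) /\ (forall a, multilinear (g a)).

Lemma biml_left V W (g : seq V -> seq V -> W) v :
  biml g -> biml (fun a b => g (v :: a) b).
Proof. by case=> g1 g2; split=> [b|a //]; apply: (ml_iot v (g1 b)). Qed.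

Lemma biml_right V W (g : seq V -> seq V -> W) n v :
  biml g -> biml (fun a b => g (map (@kos K V n) a) (v :: b)).
Proof.
case=> g1 g2; split=> [b|a]; last exact: (ml_iot v (g2 _)).
by apply: (ml_map (f := g^~ (v :: b))) => //; apply: kos_linear.
Qed.

Lemma ush_cons V W n v (g : seq V -> seq V -> W) u :
  homog n v -> (forall a, multilinear (g a)) ->
  ush g (v :: u) = ush (fun a b => g (v :: a) b) u +
    ush (fun a b => g (map (@kos K V n) a) (v :: b)) u.
Proof.
move=> hv gL /=; congr (_ + _).
apply: (sum_homog (F := fun m w =>
  ush (fun a b => g (map (@kos K V m) a) (w :: b)) u)) hv => m.
by apply: ush0 => a b; apply: (linear_fun0 (ml_head b (gL _))).
Qed.

Lemma ush_ml V W (g : seq V -> seq V -> W) : biml g -> multilinear (ush g).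
Proof.
move=> gL s; elim: s g gL => [|z s IHs] g gL t c x y /=.
  rewrite scalerDr addrACA; congr (_ + _).
    by apply: ush_linear => a b; apply: (gL.1 b [::]).
  rewrite scaler_sumr -big_split; apply: eq_bigr => n _ /=.
  by apply: ush_linear => a b; rewrite linearP; apply: (gL.2 _ [::]).
rewrite (IHs _ (biml_left z gL)) scalerDr addrACA; congr (_ + _).
rewrite scaler_sumr -big_split; apply: eq_bigr => n _ /=.
exact: (IHs _ (biml_right n _ gL)).
Qed.

(** Sizes and total degrees of the two blocks add up to those of [u]. A sign that depends on the
    whole of [u] can thus be written in terms of the blocks and compared summand by summand. *)
Lemma eq_ush_homogs V W e u (g1 g2 : seq V -> seq V -> W) :
  homogs e u -> (forall a, multilinear (g1 a)) -> (forall a, multilinear (g2 a)) ->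
  (forall ea eb a b, homogs ea a -> homogs eb b -> 
    (size a + size b = size u)%N ->
    \sum_(k <- ea) k + \sum_(k <- eb) k = \sum_(k <- e) k -> g1 a b = g2 a b) ->
  ush g1 u = ush g2 u.
Proof.
elim: u e g1 g2 => [|v u IHu] [|n e] //= g1 g2.
  by move=> _ _ _ /(_ [::] [::] [::] [::]); apply => //; rewrite !big_nil addr0.
move=> /andP[hv hu] g1L g2L g12.
have h1 : ush (fun a b => g1 (v :: a) b) u = ush (fun a b => g2 (v :: a) b) u.
  apply: (IHu e) => // ea eb a b ha hb sab eab.
  apply: (g12 (n :: ea) eb); rewrite /= ?sab ?addSn ?sab //.
    by rewrite /homogs /= hv.
  by rewrite !big_cons -addrA eab.
rewrite -[LHS]/(ush g1 (v :: u)) -[RHS]/(ush g2 (v :: u)).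
rewrite !(ush_cons _ hv) //; congr (_ + _) => //.
apply: (IHu e) => // [a|a|ea eb a b ha hb sab eab].
- exact: (ml_iot v (g1L _)).
- exact: (ml_iot v (g2L _)).
apply: (g12 ea (n :: eb)).
- exact: homogs_kos.
- by rewrite /homogs /= hv.
- by rewrite /= size_map addnS sab.
by rewrite !big_cons addrCA eab.
Qed.

Definition biform V W (d : int) (g : seq V -> seq V -> W) : Prop :=
  [/\ biml g, (forall b, gsymmetric (g^~ b)), (forall a, gsymmetric (g a)) &
      forall ea eb a b, homogs ea a -> homogs eb b ->
        homog (d + \sum_(k <- ea) k + \sum_(k <- eb) k) (g a b)].

Lemma gs_map V V' W (phi : V -> V') (f : seq V' -> W) :
  (forall n v, homog n v -> homog n (phi v)) ->
  gsymmetric f -> gsymmetric (fun u => f (map phi u)).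
Proof.
move=> hphi fS s t m n x y hx hy; rewrite !map_cat /=.
by rewrite (fS _ _ m n) //; apply: hphi.
Qed.

(** If the two vectors fall into the same block, the symmetry of [g] applies. If they are separated,
    the sign is that of the vector in the second block passing the one in the first, which happens
    in only one of the two orders. *)
Lemma ush_gs V W (g : seq V -> seq V -> W) : biml g ->
  (forall b, gsymmetric (g^~ b)) -> (forall a, gsymmetric (g a)) ->
  gsymmetric (ush g).
Proof.
move=> gL gS1 gS2 s t m n x y hx hy; elim: s g gL gS1 gS2 => [|z s IHs] g gL gS1 gS2.
  have gl w := biml_left w gL; have gr k w := biml_right k w gL.
  rewrite !cat0s (ush_cons _ hx gL.2) (ush_cons _ hy gL.2).
  rewrite (ush_cons _ hy (gl x).2) (ush_cons _ hx (gl y).2).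
  rewrite (ush_cons _ hy (gr _ _).2) (ush_cons _ hx (gr _ _).2).
  (* Regrouped so that the summands with the same assignment of [x] and [y] to the blocks face each
     other. *)
  rewrite !scalerDr -!ushZ [RHS]addrACA.
  have Zl w b c (v : V) : g (c *: v :: w) b = c *: g (v :: w) b.
    by rewrite (linear_funZ (ml_head w (gL.1 b))).
  congr (_ + _ + (_ + _)); apply: eq_ush => a b /=.
  - exact: (gS1 b [::]).
  - by rewrite (kos_homog _ hx) Zl scalerA mulrC [n * m]mulrC sgK scale1r.
  - by rewrite (kos_homog _ hy) Zl.
  - by rewrite map_kosC; apply: (gS2 _ [::]).
rewrite [LHS]/= [X in _ *: X]/=.
rewrite (IHs _ (biml_left z gL)) => [|b|a] //; last first.
  exact: (gs_iot z (gS1 b)).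
rewrite scalerDr scaler_sumr; congr (_ + _); apply: eq_bigr => k _.
apply: (IHs _ (biml_right k _ gL)) => [b|a]; last exact: (gs_iot _ (gS2 _)).
apply: (gs_map (f := g^~ (pr V k z :: b))) => // j v; exact: homog_kos.
Qed.

Lemma ush_hform V W d (g : seq V -> seq V -> W) : biform d g -> hform d (ush g).
Proof.
case=> gL gS1 gS2 gd; split; [exact: ush_ml | exact: ush_gs |].
move=> u e hu; elim: u e d g gL gd hu {gS1 gS2} => [|v u IHu] [|n e] //= d g gL gd.
  by move=> _; have := gd [::] [::] [::] [::]; rewrite !big_nil !addr0; apply.
move=> /andP[hv hu]; rewrite big_cons.
rewrite -[ush _ _ + _]/(ush g (v :: u)) (ush_cons _ hv gL.2) addrA.
apply: homogD.
  apply: IHu hu => [|ea eb a b ha hb]; first exact: biml_left.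
  have := gd (n :: ea) eb (v :: a) b; rewrite big_cons homogs_cons hv ha hb.
  by rewrite !addrA; apply.
apply: IHu hu => [|ea eb a b ha hb]; first exact: biml_right.
have := gd ea (n :: eb) (map (@kos K V n) a) (v :: b).
rewrite big_cons homogs_kos // homogs_cons hv hb => /(_ isT isT).
by rewrite [n + _]addrC addrA [d + n]addrC -!addrA [n + _]addrC !addrA.
Qed.

(* The pre-Lie product f o g: the derivative of f along the vector field g. *)
Definition ins V (W : lmodType K) (g : seq V -> V) (f : seq V -> W) : seq V -> W :=
  ush (fun a b => f (g a :: b)).
End Ush.

(** * The pre-Lie product *)

Section Ins.
Variable K : fieldType.
Implicit Types V W : gvect K.
Local Notation sg := (@sg K).

(** Parity twists on the value and on the arguments: the signs of a vector of degree [n] that passes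
    the value or the arguments of [f]. On a series of degree d they differ by the constant
    [sg (n * d)], see [KrE]. *)
Definition Kl V W n (f : seq V -> W) : seq V -> W := fun u => kos n (f u).
Definition Kr V (W : Type) n (f : seq V -> W) : seq V -> W :=
  fun u => f (map (@kos K V n) u).

Lemma ml_hform V W d (f : seq V -> W) : hform d f -> multilinear f.
Proof. by case. Qed.
Lemma gs_hform V W d (f : seq V -> W) : hform d f -> gsymmetric f.
Proof. by case. Qed.
Hint Resolve ml_hform gs_hform : core.

Lemma hform_Kl V W d n (f : seq V -> W) : hform d f -> hform d (Kl n f).
Proof. exact: hform_kosl. Qed.
Lemma hform_Kr V W d n (f : seq V -> W) : hform d f -> hform d (Kr n f).
Proof. exact: hform_kosr. Qed.

Lemma KrE V W d n (f : seq V -> W) : hform d f -> Kr n f = sg (n * d) *: Kl n f.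
Proof. by move=> hf; apply/funext => u; apply: hform_kos. Qed.

Lemma KlE V W d n (f : seq V -> W) : hform d f -> Kl n f = sg (n * d) *: Kr n f.
Proof. by move=> hf; rewrite (KrE _ hf) scalerA sgK scale1r. Qed.

Lemma ins_biml V W (g : seq V -> V) (f : seq V -> W) :
  multilinear g -> multilinear f -> biml (fun a b => f (g a :: b)).
Proof.
move=> gL fL; split=> [b|a]; last exact: (ml_iot (g a)).
by apply: (ml_comp (psi := fun v => f (v :: b))) => //; apply: ml_head.
Qed.

Lemma ins_hform V W q d (g : seq V -> V) (f : seq V -> W) :
  hform q g -> hform d f -> hform (q + d) (ins g f).
Proof.
move=> [gL gS gd] [fL fS fd]; apply: ush_hform; split.
- exact: ins_biml.
- move=> b s t m n x y hx hy /=; rewrite (gS _ _ _ _ _ _ hx hy).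
  by rewrite (linear_funZ (ml_head _ fL)).
- by move=> a; apply: (gs_iot (g a)).
move=> ea eb a b ha hb; have := fd (g a :: b) ((q + \sum_(k <- ea) k) :: eb).
rewrite -[all2 _ _ _]/(homogs _ _) homogs_cons hb gd // => /(_ isT).
by rewrite big_cons !addrA [d + q]addrC.
Qed.

(** Either [v] becomes an argument of [g], or it stays with [f]. In the second case it must be moved
    in front of [g a]; this undoes the twist of [a] and leaves only the degree [q] of [g] in the
    sign. *)
Lemma ins_cons V W q n (g : seq V -> V) (f : seq V -> W) v u :
  hform q g -> multilinear f -> gsymmetric f -> homog n v ->
  ins g f (v :: u) = ins (iot v g) f u + sg (n * q) *: ins g (iot v f) u.
Proof.
move=> hg fL fS hv; rewrite /ins (ush_cons _ hv) => [|a]; last exact: (ml_iot (g a)).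
congr (_ + _); rewrite -ushZ; apply: eq_ush => a b.
rewrite (gs_swap _ _ fL fS hv) (hform_kos _ _ hg) linearZ /= kosK.
by rewrite [LHS](linear_funZ (ml_head b (ml_iot v fL))).
Qed.

Lemma ins_linr V W (g : seq V -> V) c (f1 f2 : seq V -> W) :
  ins g (c *: f1 + f2) = c *: ins g f1 + ins g f2.
Proof. by apply/funext => u; apply: ush_linear. Qed.

Lemma insDr V W (g : seq V -> V) (f1 f2 : seq V -> W) :
  ins g (f1 + f2) = ins g f1 + ins g f2.
Proof. by have := ins_linr g 1 f1 f2; rewrite !scale1r. Qed.

Lemma insZr V W (g : seq V -> V) c (f : seq V -> W) : ins g (c *: f) = c *: ins g f.
Proof. by apply/funext => u; apply: ushZ. Qed.

Lemma ins_linl V W (f : seq V -> W) c (g1 g2 : seq V -> V) : multilinear f ->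
  ins (c *: g1 + g2) f = c *: ins g1 f + ins g2 f.
Proof.
move=> fL; apply/funext => u; apply: ush_linear => a b.
by rewrite !fctE; apply: (fL [::]).
Qed.

Lemma insDl V W (f : seq V -> W) (g1 g2 : seq V -> V) : multilinear f ->
  ins (g1 + g2) f = ins g1 f + ins g2 f.
Proof. by move=> fL; have := ins_linl 1 g1 g2 fL; rewrite !scale1r. Qed.

Lemma ins0l V W (f : seq V -> W) : multilinear f -> ins 0 f = 0.
Proof.
move=> fL; apply/funext => u; apply: ush0 => a b.
exact: (linear_fun0 (ml_head b fL)).
Qed.

Lemma ins0r V W (g : seq V -> V) : ins g (0 : seq V -> W) = 0.
Proof. by apply/funext => u; apply: ush0. Qed.

Lemma insZl V W (f : seq V -> W) c (g : seq V -> V) : multilinear f ->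
  ins (c *: g) f = c *: ins g f.
Proof. by move=> fL; have := ins_linl c g 0 fL; rewrite ins0l // !addr0. Qed.

Lemma ins_Kl V W n (g : seq V -> V) (f : seq V -> W) : ins g (Kl n f) = Kl n (ins g f).
Proof.
by apply/funext => u; rewrite /Kl /ins -(ush_push _ _ (@kos_linear _ _ n)).
Qed.

Lemma ins_Kr V W n q (g : seq V -> V) (f : seq V -> W) :
  hform q g -> multilinear f ->
  ins g (Kr n f) = sg (n * q) *: Kr n (ins g f).
Proof.
move=> hg fL; apply/funext => u; rewrite !fctE /Kr /ins ush_kos -ushZ.
apply: eq_ush => a b; rewrite (hform_kos _ _ hg).
by rewrite (linear_funZ (ml_head _ fL)) scalerA sgK scale1r.
Qed.

Lemma iot_ins V W q n (g : seq V -> V) (f : seq V -> W) v :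
  hform q g -> multilinear f -> gsymmetric f -> homog n v ->
  iot v (ins g f) = ins (iot v g) f + sg (n * q) *: ins g (iot v f).
Proof. by move=> hg fL fS hv; apply/funext => u; apply: ins_cons hv. Qed.

Lemma sub3 (M : zmodType) (a b c a' b' c' : M) :
  a + (b + c) - (a' + b' + c') = (a - a') + (b - b') + (c - c').
Proof. by rewrite !opprD [a + (b + c)]addrA addrACA; congr (_ + _); rewrite addrACA. Qed.

Lemma scale3 (M : lmodType K) c (x y z : M) :
  c *: (x + y + z) = c *: x + c *: y + c *: z.
Proof. by rewrite !scalerDr. Qed.

Lemma ml_sub V W (f g : seq V -> W) :
  multilinear f -> multilinear g -> multilinear (f - g).
Proof.
move=> fL gL s t c x y; rewrite !fctE fL gL opprD scalerBr.
by rewrite addrACA.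
Qed.

Lemma ml_scale V W c (f : seq V -> W) : multilinear f -> multilinear (c *: f).
Proof.
move=> fL s t d x y; rewrite !scalrfctE fL scalerDr !scalerA.
by rewrite [c * d]mulrC.
Qed.

(* The associator of [ins]; [assoc_sym] is the pre-Lie identity. *)
Definition assoc V W (h g : seq V -> V) (f : seq V -> W) := ins h (ins g f) - ins (ins h g) f.

Lemma iot_assoc V W p q d n (X mu : seq V -> V) (f : seq V -> W) v :
  hform p X -> hform q mu -> hform d f -> homog n v ->
  iot v (assoc X mu f) = assoc (iot v X) mu f
    + sg (n * p) *: assoc X (iot v mu) f
    + sg (n * (p + q)) *: assoc X mu (iot v f).
Proof.
move=> hX hm hf hv.
rewrite -[LHS]/(iot v (ins X (ins mu f)) - iot v (ins (ins X mu) f)).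
have := ins_hform hm hf; have := ins_hform hX hm => hXm hmf.
rewrite (iot_ins hX (ml_hform hmf) (gs_hform hmf) hv).
rewrite (iot_ins hXm (ml_hform hf) (gs_hform hf) hv).
rewrite (iot_ins hm (ml_hform hf) (gs_hform hf) hv).
rewrite (iot_ins hX (ml_hform hm) (gs_hform hm) hv).
rewrite insDr insZr insDl ?insZl; try exact: ml_hform hf.
by rewrite !scalerDr sub3 scalerA -sgD -mulrDr !scalerN.
Qed.

Lemma ml_assoc V W p q d (X mu : seq V -> V) (f : seq V -> W) :
  hform p X -> hform q mu -> hform d f -> multilinear (assoc X mu f).
Proof.
move=> hX hm hf; apply: ml_sub.
  exact: ml_hform (ins_hform hX (ins_hform hm hf)).
exact: ml_hform (ins_hform (ins_hform hX hm) hf).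
Qed.

Lemma assoc_sym V W p q d (X mu : seq V -> V) (f : seq V -> W) :
  hform p X -> hform q mu -> hform d f ->
  assoc X mu f = sg (p * q) *: assoc mu X f.
Proof.
move=> hX hm hf; apply/funext; apply: ml_ext.
- exact: ml_assoc hX hm hf.
- exact: ml_scale (ml_assoc hm hX hf).
move=> e u; elim: u e p q d X mu f hX hm hf => [|v u IHu] [|n e] // p q d X mu f hX hm hf.
  have hX0 : homog p (X [::]) by have [_ _ /(_ [::] [::] isT)] := hX; rewrite big_nil addr0.
  have hm0 : homog q (mu [::]) by have [_ _ /(_ [::] [::] isT)] := hm; rewrite big_nil addr0.
  (* Only the term in which both vectors are inserted side by side into [f] survives in the
     associator; the symmetry of [f] then exchanges them. *)
  have E p' q' (Y nu : seq V -> V) : hform p' Y -> hform q' nu -> homog p' (Y [::]) ->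
      assoc Y nu f [::] = sg (p' * q') *: f [:: Y [::]; nu [::]].
    move=> hY hn hY0.
    have -> : assoc Y nu f [::] = ins nu f [:: Y [::]] - f [:: nu [:: Y [::]]] by [].
    rewrite (ins_cons _ hn (ml_hform hf) (gs_hform hf) hY0) addrC.
    exact: addKr.
  rewrite scalefE (E p q) // (E q p) // => _; rewrite (gs_hform hf [::] [::] hX0 hm0).
  by rewrite !scalerA [q * p]mulrC.
rewrite homogs_cons => /andP[hv hu].
have hXv := hform_iot hX hv; have hmv := hform_iot hm hv; have hfv := hform_iot hf hv.
rewrite scalefE -[LHS]/(iot v _ u) -[assoc mu X f _]/(iot v _ u).
rewrite (iot_assoc hX hm hf hv) (iot_assoc hm hX hf hv).
rewrite !addfE !scalefE.
rewrite (IHu _ _ _ _ _ _ _ hXv hm hf hu).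
rewrite (IHu _ _ _ _ _ _ _ hX hmv hf hu) (IHu _ _ _ _ _ _ _ hX hm hfv hu).
rewrite scale3 !scalefE !scalerA -!sgD.
(* On the right the contractions of [mu] and of [X] come in the opposite order. *)
rewrite [X in _ = X + _]addrC.
congr (_ *: _ + _ *: _ + _ *: _).
- by congr sg; ring.
- by apply: (@sg_par _ _ _ (n * p)); ring.
- by congr sg; ring.
Qed.
End Ins.

(** * Products of series *)

Section Sprod.
Variable K : fieldType.
Implicit Types V W : gvect K.
Local Notation sg := (@sg K).

Definition pairing (W1 W2 W3 : gvect K) (beta : W1 -> W2 -> W3) : Prop :=
  [/\ forall y, linear (beta^~ y), forall x, linear (beta x) &
      forall m n x y, homog m x -> homog n y -> homog (m + n) (beta x y)].

Section Pairing.
Variables (V W1 W2 W3 : gvect K) (beta : W1 -> W2 -> W3).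
Hypothesis betaP : pairing beta.
Let bl := let: And3 h _ _ := betaP in h.
Let br := let: And3 _ h _ := betaP in h.
Let bd := let: And3 _ _ h := betaP in h.

Lemma pairing_kos n x y : beta (kos n x) (kos n y) = kos n (beta x y).
Proof.
move: x; apply: linear_ext => [c x x'|c x x'|k x hx].
- by rewrite linearP bl.
- by rewrite bl linearP.
move: y; apply: linear_ext => [c y y'|c y y'|l y hy].
- by rewrite linearP br.
- by rewrite br linearP.
rewrite (kos_homog _ hx) (kos_homog _ hy) (kos_homog _ (bd hx hy)).
by rewrite (linear_funZ (bl _)) (linear_funZ (br _)) scalerA -sgD -mulrDr.
Qed.

Lemma sprod_summand_homog k (x : W1) (h : seq V -> W2) a : homog k x ->
  \sum_(m <- supp W1) beta (pr W1 m x) (h (map (@kos K V m) a)) =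
  beta x (h (map (@kos K V k) a)).
Proof.
move=> hx.
apply: (sum_homog (F := fun m w => beta w (h (map (@kos K V m) a)))) hx => m.
exact: (linear_fun0 (bl _)).
Qed.

Lemma sprod_summand_biml (f : seq V -> W1) (h : seq V -> W2) :
  multilinear f -> multilinear h ->
  biml (fun a b => \sum_(k <- supp W1) beta (pr W1 k (f b)) (h (map (@kos K V k) a))).
Proof.
move=> fL hL; split=> c s t e x y; rewrite scaler_sumr -big_split; apply: eq_bigr => k _ /=.
  by rewrite !map_cat /= linearP hL br.
by rewrite fL linearP bl.
Qed.

Lemma sprod_ml (f : seq V -> W1) (h : seq V -> W2) :
  multilinear f -> multilinear h -> multilinear (sprod beta f h).
Proof. by move=> fL hL; apply/ush_ml/sprod_summand_biml. Qed.

Lemma sprod_hform c d (f : seq V -> W1) (h : seq V -> W2) :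
  hform c f -> hform d h -> hform (c + d) (sprod beta f h).
Proof.
move=> hf hh; have [fL fS fd] := hf; have [hL hS hd] := hh.
apply: ush_hform; split; first exact: sprod_summand_biml.
- move=> b s t m n x y hx hy; rewrite scaler_sumr; apply: eq_bigr => k _.
  rewrite !map_cat /= (hS _ _ m n) ?homog_kos //.
  by rewrite (linear_funZ (br _)).
- move=> a s t m n x y hx hy; rewrite scaler_sumr; apply: eq_bigr => k _.
  by rewrite (fS _ _ m n) // linearZ (linear_funZ (bl _)).
move=> ea eb a b ha hb; rewrite (sprod_summand_homog _ _ (fd _ _ hb)).
rewrite addrAC [c + d]addrC -addrA addrC [d + _]addrC [_ + d]addrC.
rewrite addrAC -addrA addrC.
have := bd (fd _ _ hb) (hd _ _ (homogs_kos (c + \sum_(k <- eb) k) ha)).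
by congr (homog _ _); ring.
Qed.

(** If [v] joins the arguments of [h], its twist by the degree of the value of [f] turns into
    [Kl n f]; if it joins those of [f], it passes the arguments of [h], whence [Kr n h]. *)
Lemma sprod_cons n (f : seq V -> W1) (h : seq V -> W2) v u :
  multilinear f -> multilinear h -> homog n v ->
  sprod beta f h (v :: u) =
    sprod beta (Kl n f) (iot v h) u + sprod beta (iot v f) (Kr n h) u.
Proof.
move=> fL hL hv; rewrite /sprod (ush_cons _ hv (sprod_summand_biml fL hL).2).
congr (_ + _); apply: eq_ush => a b; apply: eq_bigr => k _.
  rewrite /= (kos_homog _ hv) (linear_funZ (ml_head _ hL)).
  rewrite /Kl pr_kos (kos_homog _ (homog_pr _ _)).
  by rewrite (linear_funZ (br _)) (linear_funZ (bl _)) mulrC.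
by rewrite map_kosC.
Qed.

Lemma sprodZr c (f : seq V -> W1) (h : seq V -> W2) :
  sprod beta f (c *: h) = c *: sprod beta f h.
Proof.
apply/funext => u; rewrite scalefE /sprod -ushZ; apply: eq_ush => a b.
rewrite scaler_sumr; apply: eq_bigr => k _.
by rewrite scalefE (linear_funZ (br _)).
Qed.

Lemma sprodZl c (f : seq V -> W1) (h : seq V -> W2) :
  sprod beta (c *: f) h = c *: sprod beta f h.
Proof.
apply/funext => u; rewrite scalefE /sprod -ushZ; apply: eq_ush => a b.
rewrite scaler_sumr; apply: eq_bigr => k _.
by rewrite scalefE linearZ (linear_funZ (bl _)).
Qed.

Lemma sprodDr (f : seq V -> W1) (h h' : seq V -> W2) :
  sprod beta f (h + h') = sprod beta f h + sprod beta f h'.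
Proof.
apply/funext => u; rewrite addfE /sprod -ushD; apply: eq_ush => a b.
rewrite -big_split; apply: eq_bigr => k _ /=.
by rewrite addfE (linear_funD (br _)).
Qed.

Lemma sprodDl (f f' : seq V -> W1) (h : seq V -> W2) :
  sprod beta (f + f') h = sprod beta f h + sprod beta f' h.
Proof.
apply/funext => u; rewrite addfE /sprod -ushD; apply: eq_ush => a b.
rewrite -big_split; apply: eq_bigr => k _ /=.
by rewrite addfE linearD (linear_funD (bl _)).
Qed.

Lemma sprod0r (f : seq V -> W1) : sprod beta f 0 = 0 :> (seq V -> W3).
Proof. by rewrite -(scale0r (0 : seq V -> W2)) sprodZr scale0r. Qed.

Lemma Kl_sprod n (f : seq V -> W1) (h : seq V -> W2) :
  Kl n (sprod beta f h) = sprod beta (Kl n f) (Kl n h).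
Proof.
apply/funext => u; rewrite /Kl /sprod (ush_push _ _ (@kos_linear _ _ n)).
apply: eq_ush => a b; rewrite linear_sum; apply: eq_bigr => k _.
by rewrite /= -pairing_kos pr_kos.
Qed.

Lemma Kr_sprod n (f : seq V -> W1) (h : seq V -> W2) :
  Kr n (sprod beta f h) = sprod beta (Kr n f) (Kr n h).
Proof.
apply/funext => u; rewrite /Kr /sprod ush_kos.
by apply: eq_ush => a b; apply: eq_bigr => k _; rewrite map_kosC.
Qed.

Lemma iot_sprod n (f : seq V -> W1) (h : seq V -> W2) v :
  multilinear f -> multilinear h -> homog n v ->
  iot v (sprod beta f h) =
    sprod beta (Kl n f) (iot v h) + sprod beta (iot v f) (Kr n h).
Proof. by move=> fL hL hv; apply/funext => u; apply: sprod_cons. Qed.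

Lemma Kl_Kl W m n (f : seq V -> W) : Kl m (Kl n f) = Kl (m + n) f.
Proof. by apply/funext => u; apply: kosD. Qed.

Lemma Kr_Kr (W : Type) m n (f : seq V -> W) : Kr m (Kr n f) = Kr (m + n) f.
Proof. by apply/funext => u; rewrite /Kr map_kosD addrC. Qed.

Lemma Kl_Kr W m n (f : seq V -> W) : Kl m (Kr n f) = Kr n (Kl m f).
Proof. by []. Qed.

Lemma iot_Kl W n (f : seq V -> W) v : iot v (Kl n f) = Kl n (iot v f).
Proof. by []. Qed.

Lemma iot_Kr W m n (f : seq V -> W) v : multilinear f -> homog n v ->
  iot v (Kr m f) = sg (m * n) *: Kr m (iot v f).
Proof.
move=> fL hv; apply/funext => u; rewrite scalefE /iot /Kr /= (kos_homog _ hv).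
by rewrite (linear_funZ (ml_head _ fL)).
Qed.

Lemma ml_Kl W n (f : seq V -> W) : multilinear f -> multilinear (Kl n f).
Proof. exact: (ml_comp (@kos_linear _ _ n)). Qed.

Lemma ml_Kr W n (f : seq V -> W) : multilinear f -> multilinear (Kr n f).
Proof. exact: (ml_map (@kos_linear _ _ n)). Qed.

Lemma ml_add W (f g : seq V -> W) :
  multilinear f -> multilinear g -> multilinear (f + g).
Proof.
move=> fL gL s t c x y; rewrite !addfE fL gL scalerDr.
by rewrite addrACA.
Qed.

Lemma add6 (M : zmodType) (a b c d e f : M) :
  a + b + (c + d + (e + f)) = a + c + e + (d + (b + f)).
Proof. by rewrite (AC (2*(2*2)) (1*3*5*(4*(2*6)))). Qed.

Lemma ins_sprod q c d (g : seq V -> V) (f : seq V -> W1) (h : seq V -> W2) :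
  hform q g -> hform c f -> hform d h ->
  ins g (sprod beta f h) =
    sprod beta (Kl q f) (ins g h) + sprod beta (ins g f) (Kr q h).
Proof.
move=> hg hf hh; apply/funext; apply: ml_ext.
- exact: ml_hform (ins_hform hg (sprod_hform hf hh)).
- apply: ml_add; apply: sprod_ml.
  + exact: ml_Kl (ml_hform hf).
  + exact: ml_hform (ins_hform hg hh).
  + exact: ml_hform (ins_hform hg hf).
  + exact: ml_Kr (ml_hform hh).
move=> e u; elim: u e q c d g f h hg hf hh => [|v u IHu] [|n e] // q c d g f h hg hf hh.
  (* On the empty list, inserting [g] is contraction with the vector [g [::]]. *)
  have g0 : homog q (g [::]) by have [_ _ /(_ [::] [::] isT)] := hg; rewrite big_nil addr0.
  move=> _; rewrite -[LHS]/(sprod beta f h [:: g [::]]).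
  by rewrite (sprod_cons _ (ml_hform hf) (ml_hform hh) g0).
rewrite homogs_cons => /andP[hv hu].
have hgv := hform_iot hg hv; have hfv := hform_iot hf hv; have hhv := hform_iot hh hv.
have hfh := sprod_hform hf hh.
rewrite -[LHS]/(iot v _ u) -[RHS]/(iot v _ u).
rewrite (iot_ins hg (ml_hform hfh) (gs_hform hfh) hv).
rewrite (iot_sprod (ml_hform hf) (ml_hform hh) hv) insDr !addfE scalefE addfE.
rewrite (IHu _ _ _ _ _ _ _ hgv hf hh hu).
rewrite (IHu _ _ _ _ _ _ _ hg (hform_Kl n hf) hhv hu).
rewrite (IHu _ _ _ _ _ _ _ hg hfv (hform_Kr n hh) hu).
have -> (F G : seq V -> W3) : iot v (F + G) = iot v F + iot v G by [].
have hgf := ins_hform hg hf; have hgh := ins_hform hg hh.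
rewrite (iot_sprod (ml_Kl _ (ml_hform hf)) (ml_hform hgh) hv).
rewrite (iot_sprod (ml_hform hgf) (ml_Kr _ (ml_hform hh)) hv).
rewrite (iot_ins hg (ml_hform hh) (gs_hform hh) hv).
rewrite (iot_ins hg (ml_hform hf) (gs_hform hf) hv).
rewrite (iot_Kr _ (ml_hform hh) hv) iot_Kl !Kl_Kl ins_Kl.
rewrite (ins_Kr n hg (ml_hform hh)) !Kr_Kr !sprodDl !sprodDr !sprodZr !sprodZl.
rewrite !addfE !scalefE !scalerDr [q * n]mulrC [q + n]addrC.
rewrite !scalerA sgK scale1r.
exact: add6.
Qed.
End Pairing.

Lemma sprodA V (W1 W2 W3 W12 W23 W : gvect K)
    (b12 : W1 -> W2 -> W12) (b123 : W12 -> W3 -> W)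
    (b23 : W2 -> W3 -> W23) (b1_23 : W1 -> W23 -> W)
    (f : seq V -> W1) (h : seq V -> W2) (k : seq V -> W3) :
  pairing b12 -> pairing b123 -> pairing b23 -> pairing b1_23 ->
  (forall x y z, b123 (b12 x y) z = b1_23 x (b23 y z)) ->
  multilinear f -> multilinear h -> multilinear k ->
  sprod b123 (sprod b12 f h) k = sprod b1_23 f (sprod b23 h k).
Proof.
move=> p12 p123 p23 p1_23 bA fL hL kL; apply/funext; apply: ml_ext.
- by apply: sprod_ml => //; apply: sprod_ml.
- by apply: sprod_ml => //; apply: sprod_ml.
move=> e u; elim: u e f h k fL hL kL => [|v u IHu] [|n e] // f h k fL hL kL.
  have E0 (W1' W2' W3' : gvect K) (b : W1' -> W2' -> W3') f' h' : pairing b ->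
      sprod b f' h' [::] = b (f' [::]) (h' [::]) :> gv_sort W3'.
    move=> [bl _ _]; rewrite /sprod /=.
    by rewrite -(linear_fun_sum _ _ _ (bl (h' [::]))) pr_sum.
  by move=> _; rewrite !E0.
rewrite homogs_cons => /andP[hv hu].
rewrite (sprod_cons p123 _ (sprod_ml p12 fL hL) kL hv).
rewrite (sprod_cons p1_23 _ fL (sprod_ml p23 hL kL) hv).
rewrite (Kl_sprod p12) (iot_sprod p12 fL hL hv) (sprodDl p123) addfE.
rewrite Kr_sprod (iot_sprod p23 hL kL hv) (sprodDr p1_23) addfE -addrA.
have Kll := ml_Kl n; have Krr := ml_Kr n; have il := ml_iot v.
by congr (_ + (_ + _)); apply: (IHu e); auto.
Qed.
End Sprod.

(** * Operator-valued series, Q as a derivation, and the square of a connection *)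

Section Hom.
Variable K : fieldType.
Implicit Types V W E F : gvect K.
Local Notation sg := (@sg K).

Lemma pr_homE V W k (phi : homG V W) v :
  (pr (homG V W) k phi : 'Hom(V, W)) v =
  \sum_(n <- supp V) pr W (n + k) ((phi : 'Hom(V, W)) (pr V n v)).
Proof.
rewrite -hpE; apply: (congr1 (fun f : 'Hom(V, W) => f v)).
by apply: etrans; first apply: (lfunE _ phi).
Qed.

Lemma homog_homP V W k (phi : homG V W) : homog k phi <->
  forall n v, homog n v -> homog (n + k) ((phi : 'Hom(V, W)) v).
Proof.
have prE n v : homog n v -> (pr (homG V W) k phi : 'Hom(V, W)) v =
    pr W (n + k) ((phi : 'Hom(V, W)) v).
  move=> hv; rewrite pr_homE.
  apply: (sum_homog (F := fun m w => pr W (m + k) ((phi : 'Hom(V, W)) w))) hv => m.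
  by rewrite !linear0.
split=> [/eqP hphi n v hv | hphi].
  by rewrite -hphi (prE _ _ hv) homog_pr.
apply/eqP/lfunP; apply: linear_ext => [c x y|c x y|n v hv]; rewrite ?linearP //.
by rewrite (prE _ _ hv); apply/eqP/hphi.
Qed.

Lemma pairing_app E F :
  pairing (fun (phi : homG E F) (e : E) => (phi : 'Hom(E, F)) e).
Proof.
split=> [e c f g|f c x y|m n phi e hphi he]; rewrite ?linearP //.
  by rewrite add_lfunE scale_lfunE.
by rewrite addrC; move/homog_homP: hphi; apply.
Qed.

Lemma pairing_comp E :
  pairing (fun phi psi : homG E E => (phi \o psi)%VF : homG E E).
Proof.
split=> [e c f g|f c x y|m n phi psi hphi hpsi].
- by apply/lfunP => v; rewrite !(comp_lfunE, add_lfunE, scale_lfunE).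
- by apply/lfunP => v; rewrite !(comp_lfunE, add_lfunE, scale_lfunE) linearP.
apply/homog_homP => k v hv; rewrite comp_lfunE [m + n]addrC addrA.
by move/homog_homP: hphi; apply; move/homog_homP: hpsi; apply.
Qed.

Lemma ins_sapp V E F q c d (g : seq V -> V) (Phi : seq V -> homG E F) (r : seq V -> E) :
  hform q g -> hform c Phi -> hform d r ->
  ins g (sapp Phi r) = sapp (Kl q Phi) (ins g r) + sapp (ins g Phi) (Kr q r).
Proof. exact: (ins_sprod (pairing_app E F)). Qed.

Lemma sapp_hform V E F c d (Phi : seq V -> homG E F) (r : seq V -> E) :
  hform c Phi -> hform d r -> hform (c + d) (sapp Phi r).
Proof. exact: (sprod_hform (pairing_app E F)). Qed.

Lemma scomp_hform V E c d (Phi Psi : seq V -> homG E E) :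
  hform c Phi -> hform d Psi -> hform (c + d) (scomp Phi Psi).
Proof. exact: (sprod_hform (pairing_comp E)). Qed.

Lemma sapp_scomp V E c d k (Phi Psi : seq V -> homG E E) (r : seq V -> E) :
  hform c Phi -> hform d Psi -> hform k r ->
  sapp (scomp Phi Psi) r = sapp Phi (sapp Psi r).
Proof.
move=> [PhiL _ _] [PsiL _ _] [rL _ _].
apply: (sprodA (pairing_comp E) (pairing_app E E) (pairing_app E E)
  (pairing_app E E)) => // x y z.
by rewrite comp_lfunE.
Qed.

Lemma sappDr V E F (Phi : seq V -> homG E F) (r s : seq V -> E) :
  sapp Phi (r + s) = sapp Phi r + sapp Phi s.
Proof. exact: (sprodDr (pairing_app E F)). Qed.

Lemma sappDl V E F (Phi Psi : seq V -> homG E F) (r : seq V -> E) :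
  sapp (Phi + Psi) r = sapp Phi r + sapp Psi r.
Proof. exact: (sprodDl (pairing_app E F)). Qed.

Lemma sappZl V E F c (Phi : seq V -> homG E F) (r : seq V -> E) :
  sapp (c *: Phi) r = c *: sapp Phi r.
Proof. exact: (sprodZl (pairing_app E F)). Qed.

(** Moves the sign (-1)^l of [hvf] into the bracket, so that Q becomes, by [hvfE], minus the
    insertion of this series followed by [Kr 1]. *)
Definition twist V (lam : seq V -> V) : seq V -> V :=
  fun a => (-1) ^+ size a *: lam a.

Lemma twist_hform V d (lam : seq V -> V) : hform d lam -> hform d (twist lam).
Proof.
move=> [lL lS ld]; split=> [s t c x y|s t m n x y hx hy|u e hu]; rewrite /twist.
- by rewrite !size_cat /= lL scalerDr !scalerA mulrC.
- by rewrite !size_cat /= (lS _ _ _ _ _ _ hx hy) !scalerA mulrC.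
by apply: homogZ; apply: ld.
Qed.

Lemma hvfE V W (lam : seq V -> V) (f : seq V -> W) : multilinear f ->
  hvf lam f = - Kr 1 (ins (twist lam) f).
Proof.
move=> fL; apply/funext => u; rewrite oppfE /hvf /Kr /ins; congr (- _).
by apply: eq_ush => a b; rewrite /twist (linear_funZ (ml_head _ fL)).
Qed.

Lemma hformN V W d (f : seq V -> W) : hform d f -> hform d (- f).
Proof. by rewrite -scaleN1r; apply: hformZ. Qed.

Lemma hform_cast V W d d' (f : seq V -> W) : d = d' -> hform d f -> hform d' f.
Proof. by move=> ->. Qed.

Lemma hvf_hform V W d (lam : seq V -> V) (f : seq V -> W) :
  hform 1 lam -> hform d f -> hform (1 + d) (hvf lam f).
Proof.
move=> hl hf; rewrite (hvfE _ (ml_hform hf)); apply/hformN/hform_Kr.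
exact: ins_hform (twist_hform hl) hf.
Qed.

(** This is [ins_sprod] with [q = 1]; the sign [sg c] is the ratio of the twists [Kl 1] and [Kr 1]
    on [f]. *)
Lemma hvf_sprod V (W1 W2 W3 : gvect K) (beta : W1 -> W2 -> W3) c d
    (lam : seq V -> V) (f : seq V -> W1) (h : seq V -> W2) :
  pairing beta -> hform 1 lam -> hform c f -> hform d h ->
  hvf lam (sprod beta f h) =
  sprod beta (hvf lam f) h + sg c *: sprod beta f (hvf lam h).
Proof.
move=> bP hl hf hh; have hmu := twist_hform hl.
rewrite (hvfE _ (ml_hform (sprod_hform bP hf hh))) !hvfE; try exact: ml_hform hf;
  try exact: ml_hform hh.
rewrite (ins_sprod bP hmu hf hh).
have -> (F G : seq V -> W3) : Kr 1 (F + G) = Kr 1 F + Kr 1 G by [].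
rewrite !Kr_sprod opprD -Kl_Kr (KrE 1 hf) mul1r.
have -> : Kl 1 (sg c *: Kl 1 f) = sg c *: f.
  by apply/funext => u; rewrite /Kl !scalefE linearZ /= kosK.
rewrite (sprodZl bP) addrC -[- Kr 1 (ins _ f)]scaleN1r (sprodZl bP) scaleN1r.
rewrite -[- Kr 1 (ins _ h)]scaleN1r (sprodZr bP) !scaleN1r scalerN.
congr (- sprod _ _ _ + _).
by apply/funext => u; rewrite /Kr map_kosK.
Qed.

Lemma hvf_sapp V E F c d (lam : seq V -> V) (Phi : seq V -> homG E F) (r : seq V -> E) :
  hform 1 lam -> hform c Phi -> hform d r ->
  hvf lam (sapp Phi r) = sapp (hvf lam Phi) r + sg c *: sapp Phi (hvf lam r).
Proof. exact: (hvf_sprod (pairing_app E F)). Qed.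

Lemma covd_hform V E d (lam : seq V -> V) (D : seq V -> homG E E) (r : seq V -> E) :
  hform 1 lam -> hform 1 D -> hform d r -> hform (1 + d) (covd lam D r).
Proof.
by move=> hl hD hr; apply: hformD; [apply: hvf_hform | apply: sapp_hform].
Qed.

Hypothesis charK0 : [pchar K] =i pred0.

(** For two copies of the odd [mu], the pre-Lie identity makes the associator equal to its negative;
    characteristic zero enters to divide by 2. *)
Lemma ins_sq0 V W d (mu : seq V -> V) (f : seq V -> W) :
  hform 1 mu -> ins mu mu = 0 -> hform d f -> ins mu (ins mu f) = 0.
Proof.
move=> hmu mm0 hf; have := assoc_sym hmu hmu hf.
rewrite mulr1 sg1 scaleN1r => /eqP; rewrite -addr_eq0 -mulr2n -scaler_nat.
rewrite scaler_eq0 ((pcharf0P K).1 charK0) /= => /eqP.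
by rewrite /assoc mm0 (ins0l (ml_hform hf)) subr0.
Qed.

Lemma hvf_sq0 V W d (lam : seq V -> V) (f : seq V -> W) :
  hform 1 lam -> ins (twist lam) (twist lam) = 0 -> hform d f ->
  hvf lam (hvf lam f) = 0.
Proof.
move=> hl mm0 hf; have hmu := twist_hform hl.
rewrite (hvfE _ (ml_hform (hvf_hform hl hf))) (hvfE _ (ml_hform hf)).
rewrite -[- Kr 1 (ins _ f)]scaleN1r insZr (ins_Kr 1 hmu (ml_hform (ins_hform hmu hf))).
by rewrite (ins_sq0 hmu mm0 hf); apply/funext => u; rewrite /Kr oppfE !scalefE !scaler0 oppr0.
Qed.

(** The formula of [curvature] for an arbitrary space, so that it can be formed on [A] as well as on
    [L]. *)
Definition curv V E (lam : seq V -> V) (D : seq V -> homG E E) := hvf lam D + scomp D D.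

(** As [D] is odd, the two terms D(Q r) cancel, and no derivative of [r] is left. *)
Lemma covd_sq V E d (lam : seq V -> V) (D : seq V -> homG E E) (r : seq V -> E) :
  hform 1 lam -> ins (twist lam) (twist lam) = 0 -> hform 1 D -> hform d r ->
  covd lam D (covd lam D r) = sapp (curv lam D) r.
Proof.
move=> hl mm0 hD hr; rewrite /covd /curv.
have -> (f g : seq V -> E) : hvf lam (f + g) = hvf lam f + hvf lam g.
  by have := hvf_linear lam 1 f g; rewrite !scale1r.
rewrite (hvf_sq0 hl mm0 hr) add0r.
rewrite (hvf_sapp hl hD hr) sg1 scaleN1r sappDr sappDl (sapp_scomp hD hD hr).
by rewrite addrA subrK.
Qed.
End Hom.

(** * The Jacobi identity as mu o mu = 0 *)

Section Unsh.
Variable K : fieldType.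
Implicit Types V W : gvect K.
Local Notation sg := (@sg K).

Lemma filter_lt_enum n (l : 'I_n.+1) :
  [seq i : 'I_n.+1 <- enum 'I_n.+1 | (i < l)%N] =
  map (lift l) [seq k : 'I_n <- enum 'I_n | (k < l)%N].
Proof.
apply: (inj_map val_inj).
rewrite -(filter_map val (fun i => i < l)%N) val_enum_ord -map_comp.
have -> : map (val \o lift l) [seq k : 'I_n <- enum 'I_n | (k < l)%N] =
    map val [seq k : 'I_n <- enum 'I_n | (k < l)%N].
  by apply/eq_in_map => k; rewrite mem_filter => /andP[kl _]; rewrite /= /bump leqNgt kl.
rewrite -(filter_map val (fun i => i < l)%N) val_enum_ord.
rewrite (_ : iota 0 n.+1 = iota 0 n ++ [:: n]); last by rewrite -addn1 iotaD.
by rewrite filter_cat /= ltnNge -ltnS ltn_ord /= cats0.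
Qed.

Lemma filter_ge_enum n (l : 'I_n.+1) :
  [seq i : 'I_n.+1 <- enum 'I_n.+1 | (l <= i)%N] =
  l :: map (lift l) [seq k : 'I_n <- enum 'I_n | (l <= k)%N].
Proof.
have fge m k : (l <= m)%N -> [seq i <- iota m k | (l <= i)%N] = iota m k.
  by move=> lm; apply/all_filterP/allP => i; rewrite mem_iota => /andP[/(leq_trans lm)].
have flt k : [seq i <- iota 0 l ++ k | (l <= i)%N] = [seq i <- k | (l <= i)%N].
  rewrite filter_cat (_ : [seq i <- iota 0 l | _] = [::]) //.
  apply/eqP; rewrite -(negbK (_ == _)) -has_filter; apply/hasPn => i.
  by rewrite mem_iota -ltnNge.
have ln : (l <= n)%N by rewrite -ltnS.
apply: (inj_map val_inj).
rewrite -(filter_map val (fun i => l <= i)%N) val_enum_ord map_cons -map_comp.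
have -> : map (val \o lift l) [seq k : 'I_n <- enum 'I_n | (l <= k)%N] =
    map (addn 1) (map val [seq k : 'I_n <- enum 'I_n | (l <= k)%N]).
  by rewrite -map_comp; apply/eq_in_map => k; rewrite mem_filter => /andP[kl _]; rewrite /= /bump kl.
rewrite -(filter_map val (fun i => l <= i)%N) val_enum_ord.
have -> : iota 0 n.+1 = iota 0 l ++ (l : nat) :: iota l.+1 (n - l).
  by rewrite -{1}(subnKC (ltnW (ltn_ord l))) iotaD subSn.
have -> : iota 0 n = iota 0 l ++ iota l (n - l) by rewrite -{1}(subnKC ln) iotaD.
by rewrite !flt /= leqnn !fge // -iotaDl.
Qed.

Section LiftPerm.
Variables (n : nat) (l : 'I_n.+1) (s : 'S_n).
Local Notation s' := (lift_perm l ord0 s).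

Lemma ltn_lift m (h : 'I_m) (i j : 'I_m.-1) : (lift h i < lift h j)%N = (i < j)%N.
Proof. by rewrite /= /bump; lia. Qed.

(** The least value sits at position [l], so it is inverted with all the earlier positions and with
    none of the later ones. *)
Lemma koszul_lift (d : 'I_n.+1 -> int) :
  koszul K d s' =
  \prod_(k < n | (k < l)%N) sg (d (lift ord0 (s k)) * d ord0) *
  koszul K (d \o lift ord0) s.
Proof.
rewrite /koszul (bigD1_ord l) //= lift_perm_id big1 ?mul1r; last first.
  by move=> j; rewrite andbF.
rewrite [X in _ = X * _]big_mkcond -big_split; apply: eq_bigr => k _ /=.
rewrite big_mkcond (bigD1_ord l) //= -big_mkcond lift_perm_id lift_perm_lift.
congr (_ * _).
  by rewrite (_ : (_ && _) = (k < l)%N) // /= /bump; lia.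
rewrite big_mkcond [RHS]big_mkcond; apply: eq_bigr => j _.
rewrite lift_perm_lift; congr (if _ then _ else _).
by congr (_ && _); apply: (ltn_lift l k j).
Qed.

(** Position [l] heads the second block and carries the least value, hence adds no condition. *)
Lemma unshuffle_lift : unshuffle l s' = unshuffle l s.
Proof.
apply/forallP/forallP => us i; apply/forallP => j; apply/implyP => /andP[ij jl].
  have /forallP/(_ (lift l j)) := us (lift l i).
  rewrite !lift_perm_lift !ltn_lift ij => /implyP; apply.
  by move: ij jl; rewrite /= /bump; lia.
case: (unliftP l i) ij jl => [i' ->|->]; case: (unliftP l j) => [j' ->|->]; last first.
- by rewrite ltnn.
- by rewrite lift_perm_id lift_perm_lift.
- by rewrite /= /bump; lia.
rewrite !lift_perm_lift !ltn_lift => ij jl.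
have /forallP/(_ j') := us i'; rewrite ij => /implyP; apply.
by move: jl; rewrite /= /bump; lia.
Qed.

Lemma map_lift_lt (T : Type) (u : 'I_n.+1 -> T) :
  [seq u (s' i) | i : 'I_n.+1 <- enum 'I_n.+1 & (i < l)%N] =
  [seq u (lift ord0 (s i)) | i : 'I_n <- enum 'I_n & (i < l)%N].
Proof.
by rewrite filter_lt_enum -map_comp; apply: eq_map => i /=; rewrite lift_perm_lift.
Qed.

Lemma map_lift_ge (T : Type) (u : 'I_n.+1 -> T) :
  [seq u (s' i) | i : 'I_n.+1 <- enum 'I_n.+1 & (l <= i)%N] =
  u ord0 :: [seq u (lift ord0 (s i)) | i : 'I_n <- enum 'I_n & (l <= i)%N].
Proof.
rewrite filter_ge_enum /= -map_comp lift_perm_id; congr (_ :: _).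
by apply: eq_map => i /=; rewrite lift_perm_lift.
Qed.
End LiftPerm.

Section LiftPerm0.
Variables (n : nat) (l : 'I_n.+1) (s : 'S_n).
Local Notation s' := (lift_perm ord0 ord0 s).

Lemma unshuffle_lift0 : unshuffle l.+1 s' = unshuffle l s.
Proof.
apply/forallP/forallP => us i; apply/forallP => j; apply/implyP => /andP[ij jl].
  have /forallP/(_ (lift ord0 j)) := us (lift ord0 i).
  rewrite !lift_perm_lift !ltn_lift ij => /implyP; apply.
  by move: ij jl; rewrite /= /bump; lia.
case: (unliftP ord0 i) ij jl => [i' ->|->]; case: (unliftP ord0 j) => [j' ->|->] //; last first.
  by rewrite lift_perm_id lift_perm_lift.
rewrite !lift_perm_lift !ltn_lift => ij jl.
have /forallP/(_ j') := us i'; rewrite ij => /implyP; apply.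
by move: jl; rewrite /= /bump; lia.
Qed.

Lemma map_lift0_lt (T : Type) (u : 'I_n.+1 -> T) :
  [seq u (s' i) | i : 'I_n.+1 <- enum 'I_n.+1 & (i < l.+1)%N] =
  u ord0 :: [seq u (lift ord0 (s i)) | i : 'I_n <- enum 'I_n & (i < l)%N].
Proof.
rewrite enum_ordSl /= lift_perm_id filter_map -!map_comp; congr (_ :: _).
rewrite (eq_filter (a2 := fun i : 'I_n => (i < l)%N)) => [|i].
  by apply: eq_map => i /=; rewrite lift_perm_lift.
by rewrite /= /bump; lia.
Qed.

Lemma map_lift0_ge (T : Type) (u : 'I_n.+1 -> T) :
  [seq u (s' i) | i : 'I_n.+1 <- enum 'I_n.+1 & (l.+1 <= i)%N] =
  [seq u (lift ord0 (s i)) | i : 'I_n <- enum 'I_n & (l <= i)%N].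
Proof.
rewrite enum_ordSl /= filter_map -!map_comp.
rewrite (eq_filter (a2 := fun i : 'I_n => (l <= i)%N)) => [|i].
  by apply: eq_map => i /=; rewrite lift_perm_lift.
by rewrite /= /bump; lia.
Qed.
End LiftPerm0.

(** An unshuffle increases on each block, so its least value is taken at the first position of one
    of them. *)
Lemma unshuffle_ord0 n l (s : 'S_n.+1) : unshuffle l s ->
  forall i, s i = ord0 -> (i = ord0 /\ (0 < l)%N) \/ l = i :> nat.
Proof.
move=> /forallP us i si.
have {}us (j k : 'I_n.+1) : (j < k)%N -> ((k < l) || (l <= j))%N -> (s j < s k)%N.
  by move=> jk h; have /forallP/(_ k)/implyP := us j; apply; rewrite jk.
have [il|li] := ltnP i l.
  left; split; last exact: leq_ltn_trans il.
  apply/eqP/negPn/negP => i0; suff : (s ord0 < s i)%N by rewrite si.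
  by apply: us; rewrite ?il // lt0n.
right; apply/eqP; rewrite eqn_leq li leqNgt; apply/negP => {}li.
have ln : (l < n.+1)%N by apply: ltn_trans li _.
by have := us (Ordinal ln) i li; rewrite leqnn orbT si => /(_ isT).
Qed.

Lemma sum_lift_perm (M : nmodType) n (l : 'I_n.+1) (P : pred 'S_n.+1) (F : 'S_n.+1 -> M) :
  \sum_(s : 'S_n.+1 | P s && (s l == ord0)) F s =
  \sum_(s : 'S_n | P (lift_perm l ord0 s)) F (lift_perm l ord0 s).
Proof.
rewrite (reindex (lift_perm l ord0)) /=.
  by apply: eq_bigl => s; rewrite lift_perm_id eqxx andbT.
(* [drop] deletes the position [i] together with its value, which inverts [lift_perm]. The default
   [k] is never returned, since [s (lift i k)] differs from [s i]. *)
pose drop i (s : 'S_n.+1) k := odflt k (unlift (s i) (s (lift i k))).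
have dropK i (s : 'S_n.+1) k : lift (s i) (drop i s k) = s (lift i k).
  rewrite /drop; have := neq_lift i k.
  by rewrite -(can_eq (permK s)) => /unlift_some[] ? ? ->.
have drop_inj : injective (drop l _).
  move=> s; apply: can_inj (drop (s l) s^-1%g) _ => k.
  by rewrite {1}/drop dropK !permK liftK.
exists (fun s => perm (drop_inj s)) => [s _ | s].
  by apply/permP=> k; rewrite permE /drop lift_perm_lift lift_perm_id liftK.
rewrite inE => /andP[_ /eqP sl]; apply/permP=> k.
case: (unliftP l k) => [k'|] ->; rewrite ?lift_perm_id //.
by rewrite lift_perm_lift -sl permE dropK.
Qed.

(** The recursion behind [ush]: index 0 heads the first block, which needs [l >= 1], or the second
    one, which needs [l <= n]; deleting it leaves an unshuffle of [n] indices. *)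
Lemma sum_unshuffle_rec (M : nmodType) n (F : nat -> 'S_n.+1 -> M) :
  \sum_(l < n.+2) \sum_(s : 'S_n.+1 | unshuffle l s) F l s =
  \sum_(l < n.+1) \sum_(s : 'S_n | unshuffle l s) F l.+1 (lift_perm ord0 ord0 s) +
  \sum_(l < n.+1) \sum_(s : 'S_n | unshuffle l s) F l (lift_perm l ord0 s).
Proof.
(* For [l = 0] the position 0 belongs to the second block, hence the test [0 < l]. *)
have E l : \sum_(s : 'S_n.+1 | unshuffle l s) F l s =
   \sum_(s : 'S_n.+1 | unshuffle l s && ((0 < l)%N && (s ord0 == ord0))) F l s +
   \sum_(s : 'S_n.+1 | unshuffle l s && ~~ ((0 < l)%N && (s ord0 == ord0))) F l s.
  by rewrite -bigID.
rewrite (eq_bigr _ (fun (l : 'I_n.+2) _ => E l)) big_split /=; congr (_ + _).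
  rewrite big_ord_recl big1 ?add0r => [|s]; last by rewrite andbF.
  apply: eq_bigr => l _; rewrite /= sum_lift_perm.
  by apply: eq_bigl => s; apply: unshuffle_lift0.
(* For [l = n.+1] the second block is empty, so that index 0 has to head the first one. *)
rewrite big_ord_recr /= [X in _ + X]big1 ?addr0 => [|s]; last first.
  case/andP=> us /negP[]; have [[i0 _]|] := unshuffle_ord0 us (permKV s ord0).
    by rewrite -{1}i0 permKV.
  by move=> nE; have := ltn_ord (s^-1%g ord0); rewrite -nE ltnn.
apply: eq_bigr => l _.
rewrite (eq_bigl (fun s : 'S_n.+1 => unshuffle l s && (s l == ord0))) => [|s].
  by rewrite sum_lift_perm; apply: eq_bigl => s; apply: unshuffle_lift.
have [us|//] := boolP (unshuffle l s); rewrite /=.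
have [[i0 l0]|lE] := unshuffle_ord0 us (permKV s ord0).
  have s0 : s ord0 = ord0 by rewrite -{1}i0 permKV.
  rewrite l0 s0 eqxx /=; symmetry; apply/negbTE; apply/eqP => sl.
  have : l = ord0 by apply: (@perm_inj _ s); rewrite s0.
  by move=> lE; rewrite lE in l0.
have -> : l = (s^-1)%g ord0 by apply: val_inj.
rewrite permKV eqxx; apply/negP => /andP[l0 /eqP s0].
by move: l0; rewrite -{1}s0 permK.
Qed.

Lemma kos_prod V W (I : Type) (r : seq I) (f : seq V -> W) m (d : I -> int) (u : I -> V) :
  multilinear f -> (forall i, homog (d i) (u i)) ->
  f (map (@kos K V m) [seq u i | i <- r]) =
  (\prod_(i <- r) sg (d i * m)) *: f [seq u i | i <- r].
Proof.
move=> fL hu; elim: r f fL => [|i r IHr] f fL /=; first by rewrite big_nil scale1r.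
rewrite (kos_homog _ (hu i)) (linear_funZ (ml_head _ fL)) big_cons.
by have := IHr _ (ml_iot (u i) fL); rewrite /iot => ->; rewrite scalerA [m * d i]mulrC.
Qed.

(** Links the recursive [ush] to the explicit sums of [lam_jacobi]. When the head goes to the second
    block, the twist of the first block yields the product that [koszul_lift] splits off. *)
Lemma ush_unshuffle V W n (u : 'I_n -> V) (d : 'I_n -> int) (g : seq V -> seq V -> W) :
  biml g -> (forall i, homog (d i) (u i)) ->
  ush g [seq u i | i <- enum 'I_n] =
  \sum_(l < n.+1) \sum_(s : 'S_n | unshuffle l s) koszul K d s *:
    g [seq u (s i) | i : 'I_n <- enum 'I_n & (i < l)%N]
      [seq u (s i) | i : 'I_n <- enum 'I_n & (l <= i)%N].
Proof.
elim: n u d g => [|n IHn] u d g gL hu.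
  rewrite big_ord1 (big_pred1 1%g) => [|s]; last first.
    have -> : s = 1%g by apply/permP => -[].
    by rewrite /= eqxx; apply/forallP => -[].
  by rewrite /koszul big_ord0 scale1r !(size0nil (size_enum_ord 0)).
rewrite [in LHS]enum_ordSl map_cons -map_comp (ush_cons _ (hu ord0) gL.2).
have hu' i : homog ((d \o lift ord0) i) ((u \o lift ord0) i) by apply: hu.
rewrite (IHn _ _ _ (biml_left _ gL) hu') (IHn _ _ _ (biml_right _ _ gL) hu').
pose F (l : nat) (s : 'S_n.+1) := koszul K d s *:
  g [seq u (s i) | i : 'I_n.+1 <- enum 'I_n.+1 & (i < l)%N]
    [seq u (s i) | i : 'I_n.+1 <- enum 'I_n.+1 & (l <= i)%N].
rewrite -[RHS]/(\sum_(l < n.+2) \sum_(s : 'S_n.+1 | unshuffle l s) F l s).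
rewrite sum_unshuffle_rec /F.
congr (_ + _); apply: eq_bigr => l _; apply: eq_bigr => s _.
  by rewrite map_lift0_lt map_lift0_ge koszul_lift big_pred0 ?mul1r.
rewrite map_lift_lt map_lift_ge koszul_lift mulrC -scalerA; congr (_ *: _).
rewrite (kos_prod _ _ (gL.1 _) (fun i => hu' (s i))).
by rewrite big_filter big_enum_cond.
Qed.

Lemma lam_lam (L : linfty K) : ins (lam L) (lam L) = 0.
Proof.
have [lL lS ld] := lam_hform L.
apply/funext; apply: ml_ext => [||e u hu].
- exact: ml_hform (ins_hform (lam_hform L) (lam_hform L)).
- by move=> s t c x y; rewrite !zerofE scaler0 addr0.
pose v (i : 'I_(size u)) := tnth (in_tuple u) i.
pose d (i : 'I_(size u)) := nth 0 e i.
have hv i : homog (d i) (v i).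
  rewrite /v /d (tnth_nth 0) /=; move: i hu; rewrite /homogs all2E => i /andP[/eqP se].
  move/all_nthP => /(_ (0, 0) i); rewrite size_zip se minnn ltn_ord => /(_ isT).
  by rewrite nth_zip.
have uE : [seq v i | i <- enum 'I_(size u)] = u.
  by rewrite map_tnth_enum.
rewrite -{1}uE /ins (ush_unshuffle (ins_biml lL lL) hv).
exact: lam_jacobi.
Qed.

(** The two signs multiply to the constant (-1)^(size u + 1): the outer bracket has one argument
    more than the second block. *)
Lemma twist_twist (L : linfty K) : ins (twist (lam L)) (twist (lam L)) = 0.
Proof.
have lL := ml_hform (lam_hform L); have tL := ml_hform (twist_hform (lam_hform L)).
apply/funext; apply: ml_ext => [||e u hu].
- exact: ush_ml (ins_biml tL tL).
- by move=> s t c x y; rewrite !zerofE scaler0 addr0.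
have -> : ins (twist (lam L)) (twist (lam L)) u =
    ush (fun a b => (-1) ^+ (size u).+1 *: lam L (lam L a :: b)) u.
  apply: (eq_ush_homogs hu) => [a|a|ea eb a b _ _ sab _].
  - exact: (ins_biml tL tL).2.
  - exact: (ml_scale ((-1) ^+ (size u).+1) ((ins_biml lL lL).2 a)).
  rewrite /twist /= [lam L (_ *: _ :: _)](linear_funZ (ml_head b lL)) scalerA.
  by rewrite -exprD addSn addnC sab.
by rewrite ushZ -/(ins (lam L) (lam L)) lam_lam !zerofE scaler0.
Qed.
End Unsh.

Section LinfunE.
Variables (K : fieldType) (aT rT : vectType K) (f : aT -> rT).
Hypothesis fL : linear f.
Lemma linfun_linE v : linfun f v = f v.
Proof.
pose F : {linear aT -> rT} := HB.pack f (GRing.isLinear.Build K aT rT _ f fL).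
exact: (lfunE F v).
Qed.
End LinfunE.

(** * The commutator of a connection with a vector field *)

Section CovdIns.
Variable K : fieldType.
Implicit Types V W E F : gvect K.
Local Notation sg := (@sg K).

Lemma KrD V W n (f g : seq V -> W) : Kr n (f + g) = Kr n f + Kr n g.
Proof. by []. Qed.
Lemma KrZ V W n c (f : seq V -> W) : Kr n (c *: f) = c *: Kr n f.
Proof. by []. Qed.
Lemma Kr0 V W n : Kr n (0 : seq V -> W) = 0. Proof. by []. Qed.
Lemma KrC V W m n (f : seq V -> W) : Kr m (Kr n f) = Kr n (Kr m f).
Proof. by rewrite !Kr_Kr addrC. Qed.
Lemma KrK V W n (f : seq V -> W) : Kr n (Kr n f) = f.
Proof. by apply/funext => u; rewrite /Kr map_kosK. Qed.

Lemma ml_kos V W n (f : seq V -> W) e u : multilinear f -> homogs e u ->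
  f (map (@kos K V n) u) = sg (n * \sum_(k <- e) k) *: f u.
Proof.
elim: u e f => [|v u IHu] [|k e] //= f fL.
  by rewrite big_nil mulr0 sg0 scale1r.
case/andP => hv hu.
rewrite (kos_homog _ hv) (linear_funZ (ml_head _ fL)).
rewrite -[f (v :: map _ _)]/(iot v f (map _ u)) (IHu e _ (ml_iot v fL) hu).
by rewrite scalerA -sgD -mulrDr big_cons.
Qed.

(** Insertion puts the inserted vector first, whereas [DB] takes the module argument last. *)
Lemma gs_rcons V W (f : seq V -> W) n v e u : gsymmetric f -> homog n v -> homogs e u ->
  f (v :: u) = sg (n * \sum_(k <- e) k) *: f (rcons u v).
Proof.
move=> fS hv; elim: u e f fS => [|w u IHu] [|k e] //= f fS.
  by rewrite big_nil mulr0 sg0 scale1r.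
case/andP => hw hu.
rewrite (fS [::] u _ _ _ _ hv hw) cat0s.
rewrite -[f (w :: v :: u)]/(iot w f (v :: u)) (IHu e _ (gs_iot w fS) hu).
by rewrite scalerA sgE -sgD -mulrDr big_cons.
Qed.

(** By the pre-Lie identity, the commutator of Q with the derivation along [X] is the derivation
    along [[mu, X]]; the Leibniz rule for [sapp] adds the derivative of [D] along [X]. In the two
    correction terms [G] is differentiated at most along [[mu, X]], so both vanish on A if [G] does
    and [[mu, X]] is tangent to A. *)
Lemma covd_ins V E p d (lam : seq V -> V) (D : seq V -> homG E E)
    (X : seq V -> V) (G : seq V -> E) :
  hform 1 lam -> hform 1 D -> hform p X -> hform d G ->
  covd lam D (Kr p (ins X G)) =
  sg p *: (Kr p (ins X (covd lam D G)) -
    (Kr 1 (Kr p (ins (ins (twist lam) X - sg p *: ins X (twist lam)) G)) +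
     Kr p (sapp (ins X D) (Kr p G)))).
Proof.
move=> hl hD hX hG; have hmu := twist_hform hl.
set mu := twist lam in hmu *.
have hXG := ins_hform hX hG; have hmG := ins_hform hmu hG.
rewrite /covd (hvfE _ (ml_hform (hform_Kr p hXG))) -/mu.
rewrite (ins_Kr p hmu (ml_hform hXG)) mulr1.
have -> : ins mu (ins X G) = sg p *: ins X (ins mu G) +
    ins (ins mu X - sg p *: ins X mu) G.
  have := assoc_sym hmu hX hG; rewrite mul1r /assoc => /eqP; rewrite subr_eq => /eqP ->.
  have GL := ml_hform hG.
  rewrite [in RHS]insDl // -scaleNr insZl // scalerBr scaleNr.
  by rewrite -!addrA; congr (_ + _); rewrite addrC.
have -> : sapp D (Kr p (ins X G)) = sg p *: (Kr p (ins X (sapp D G)) -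
    Kr p (sapp (ins X D) (Kr p G))).
  rewrite (ins_sapp hX hD hG) KrD addrK.
  rewrite [Kr p (sapp (Kl p D) _)]Kr_sprod -Kl_Kr (KrE p hD) mulr1.
  have -> : Kl p (sg p *: Kl p D) = sg p *: D.
    by apply/funext => u; rewrite /Kl !scalefE linearZ /= kosK.
  by rewrite [sprod _ (sg p *: D) _]sappZl scalerA sgK scale1r.
rewrite insDr (hvfE _ (ml_hform hG)) -/mu -[- Kr 1 (ins mu G)]scaleN1r insZr.
rewrite (ins_Kr 1 hX (ml_hform hmG)) mul1r.
rewrite !KrD !KrZ scaleN1r KrC KrD KrZ.
by rewrite -scalerN -scalerDr !opprD addrACA.
Qed.
End CovdIns.

(** * A graded splitting of L, and restriction of series to A *)

Section Pair.
Variables (K : fieldType) (L : linfty K) (A : subalg L).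
Implicit Types V W E F : gvect K.
Local Notation sg := (@sg K).
Local Notation SA := (subA A).
Local Notation B := (quoLA A).
Local Notation incl := (@inclA K L A).
Local Notation proj := (@projB K L A).

Lemma incl_linear : linear incl.
Proof. by move=> c x y; rewrite /inclA linearP. Qed.

Lemma incl_in a : incl a \in (A : {vspace L}).
Proof. exact: subvsP. Qed.

Lemma incl_inj : injective incl.
Proof. by move=> a b; apply: val_inj. Qed.

Lemma pr_in_sub n (v : L) : v \in (A : {vspace L}) -> pr L n v \in (A : {vspace L}).
Proof. by move=> vA; apply: (subvP (subalg_graded A n)); apply: memv_img. Qed.

Lemma incl_pr n a : incl (pr SA n a) = pr L n (incl a).
Proof.
rewrite /inclA /pr /= (linfun_linE (f := fun a => vsproj A (pr L n (vsval a)))) => [|c x y].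
  by rewrite vsprojK // pr_in_sub // subvsP.
by rewrite !linearP.
Qed.

Lemma homog_incl n a : homog n a -> homog n (incl a).
Proof. exact: (homogP incl_linear incl_pr). Qed.

Lemma homogs_incl e u : homogs e u -> homogs e (map incl u).
Proof.
elim: u e => [|v u IHu] [|k e] //= /andP[hv hu].
by apply/andP; split; [apply: homog_incl | apply: IHu].
Qed.

Lemma incl_kos n a : incl (kos n a) = kos n (incl a).
Proof. exact: (kos_comm incl_linear homog_incl). Qed.

Lemma map_incl_kos n u : map incl (map (@kos K SA n) u) = map (@kos K L n) (map incl u).
Proof. by rewrite -!map_comp; apply: eq_map => a /=; apply: incl_kos. Qed.

Lemma proj_linear : linear proj.
Proof. by move=> c x y; rewrite /projB linearP. Qed.

Lemma proj_pr n v : proj (pr L n v) = pr B n (proj v).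
Proof. by rewrite /projB -(quo_pr_quo (subalg_graded A)). Qed.

Lemma proj_eq0 v : (proj v == 0) = (v \in (A : {vspace L})).
Proof. exact: quo_eq0. Qed.

Lemma proj_incl a : proj (incl a) = 0.
Proof. by apply/eqP; rewrite proj_eq0 incl_in. Qed.

Lemma lift_linear : linear (@liftB K L A).
Proof. by move=> c x y; rewrite /liftB linearP. Qed.

Lemma proj_lift b : proj (liftB b) = b.
Proof. exact: quo_val. Qed.

(* Unlike [liftB], this section of the projection has degree 0. *)
Definition glift (b : B) : L := \sum_(n <- supp L) pr L n (liftB (pr B n b)).

Lemma glift_linear : linear glift.
Proof.
move=> c x y; rewrite /glift scaler_sumr -big_split; apply: eq_bigr => n _ /=.
by rewrite linearP lift_linear linearP.
Qed.

Lemma proj_glift b : proj (glift b) = b.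
Proof.
rewrite (linear_fun_sum _ _ _ proj_linear) -[RHS](@pr_sum _ B).
by apply: eq_bigr => n _; rewrite proj_pr proj_lift pr_pr eqxx.
Qed.

Lemma glift_pr n b : glift (pr B n b) = pr L n (glift b).
Proof.
have hL (b' : B) : homog n b' -> glift b' = pr L n (liftB b').
  apply: (sum_homog (V := B) (F := fun m w => pr L m (liftB w))) => m.
  by rewrite (linear_fun0 lift_linear) linear0.
rewrite (hL _ (homog_pr _ _)) /glift linear_sum /=.
have [nL|nL] := boolP (n \in supp L).
  rewrite (bigD1_seq n) ?supp_uniq //= pr_pr eqxx big1 ?addr0 // => m /negPf mn.
  by rewrite pr_pr eq_sym mn.
rewrite pr_supp // big_seq big1 // => m mL; rewrite pr_pr; case: eqP => // nm.
by rewrite nm mL in nL.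
Qed.

Lemma homog_glift n b : homog n b -> homog n (glift b).
Proof. exact: (homogP glift_linear glift_pr). Qed.

(** The projection of L onto A along the image of [glift]. It has degree 0, so composing with it
    extends a series on A to one on L of the same degree. *)
Definition retr (l : L) : SA := vsproj A (l - glift (proj l)).

Lemma retr_linear : linear retr.
Proof.
by move=> c x y; rewrite /retr proj_linear glift_linear opprD addrACA -scalerBr linearP.
Qed.

Lemma incl_retr l : incl (retr l) = l - glift (proj l).
Proof.
rewrite /inclA /retr vsprojK // -proj_eq0 (linear_funD proj_linear).
by rewrite -scaleN1r (linear_funZ proj_linear) proj_glift scaleN1r subrr.
Qed.

Lemma retr_incl a : retr (incl a) = a.
Proof.
by apply: incl_inj; rewrite incl_retr proj_incl (linear_fun0 glift_linear) subr0.
Qed.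

Lemma map_retr_incl u : map retr (map incl u) = u.
Proof. by rewrite -map_comp -[RHS]map_id; apply: eq_map => a /=; rewrite retr_incl. Qed.

Lemma retr_glift b : retr (glift b) = 0.
Proof.
by apply: incl_inj; rewrite incl_retr proj_glift subrr (linear_fun0 incl_linear).
Qed.

Lemma homog_retr n l : homog n l -> homog n (retr l).
Proof.
apply: (homogP retr_linear) => m v; apply: incl_inj.
by rewrite incl_pr !incl_retr proj_pr glift_pr linearB.
Qed.

Lemma lam_incl u : lam L (map incl u) \in (A : {vspace L}).
Proof.
apply: Defs.subalg_closed => v /mapP[a _ ->].
exact: incl_in.
Qed.

Lemma incl_lamA u : incl (lamA u) = lam L (map incl u).
Proof. by rewrite /inclA /lamA vsprojK // lam_incl. Qed.

Lemma lamA_hform : hform 1 (lamA (A := A)).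
Proof.
have [lL lS ld] := hform_pull incl_linear homog_incl (lam_hform L).
split=> [s t c x y|s t m n x y hx hy|u e hu]; try apply: incl_inj.
- by rewrite incl_linear !incl_lamA lL.
- by rewrite (linear_funZ incl_linear) !incl_lamA (lS _ _ _ _ _ _ hx hy).
by rewrite /homog; apply/eqP/incl_inj; rewrite incl_pr incl_lamA; apply/eqP/ld.
Qed.

Lemma twist_incl u : twist (lam L) (map incl u) = incl (twist (lamA (A := A)) u).
Proof. by rewrite /twist (linear_funZ incl_linear) incl_lamA size_map. Qed.

Local Notation restr f := (@restrA K L A _ f).

Lemma hform_restr W d (f : seq L -> W) : hform d f -> hform d (restr f).
Proof. exact: (hform_pull incl_linear homog_incl). Qed.

Lemma restrD W (f g : seq L -> W) : restr (f + g) = restr f + restr g.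
Proof. by []. Qed.
Lemma restrZ W c (f : seq L -> W) : restr (c *: f) = c *: restr f.
Proof. by []. Qed.

Lemma restr_ush (W : lmodType K) (g : seq L -> seq L -> W) u :
  ush g (map incl u) = ush (fun a b => g (map incl a) (map incl b)) u.
Proof. by symmetry; apply: (ush_map (V := SA)) incl_linear incl_pr. Qed.

Lemma restr_Kr W n (f : seq L -> W) : restr (Kr n f) = Kr n (restr f).
Proof. by apply/funext => u; rewrite /restrA /Kr map_incl_kos. Qed.

Lemma restr_sprod (W1 W2 W3 : gvect K) (beta : W1 -> W2 -> W3) f h :
  restr (sprod beta f h) = sprod beta (restr f) (restr h).
Proof.
apply/funext => u; rewrite /restrA /sprod restr_ush; apply: eq_ush => a b.
by apply: eq_bigr => k _; rewrite map_incl_kos.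
Qed.

Lemma restr_hvf W (f : seq L -> W) : restr (hvf (lam L) f) = hvf (lamA (A := A)) (restr f).
Proof.
apply/funext => u; rewrite /restrA /hvf -map_incl_kos restr_ush; congr (- _).
by apply: eq_ush => a b; rewrite size_map -incl_lamA.
Qed.

Lemma restr_covd E (D : seq L -> homG E E) (r : seq L -> E) :
  restr (covd (lam L) D r) = covd (lamA (A := A)) (restr D) (restr r).
Proof. by rewrite /covd restrD restr_hvf /sapp restr_sprod. Qed.

Lemma restr_curv E (D : seq L -> homG E E) :
  restr (curv (lam L) D) = curv (lamA (A := A)) (restr D).
Proof. by rewrite /curv restrD restr_hvf /scomp restr_sprod. Qed.

(* Apply d^2 = 0 to the constant series. *)
Lemma module_flat E (D : seq SA -> homG E E) : is_module D -> curv (lamA (A := A)) D = 0.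
Proof.
move=> [hD D2]; apply/funext => u; apply/lfunP => e.
suff -> : (curv (lamA (A := A)) D u : 'Hom(E, E)) e = 0 by rewrite zerofE lfunE.
pose cst (e : E) : seq SA -> E := fun u => if u is [::] then e else 0.
have cst_series : cst e \in @series K SA E.
  apply/asboolP; exists [seq cst (pr E n e) | n <- supp E].
    move=> _ /mapP[n _ ->]; exists n; split.
    - by move=> [|? ?] t c x y; rewrite /= scaler0 addr0.
    - by move=> [|? ?] t m k x y _ _; rewrite /= scaler0.
    move=> [|v w] [|k d] //= _; last exact: homog0.
    by rewrite big_nil addr0 homog_pr.
  rewrite big_map; apply/funext => w; rewrite /cst.
  rewrite fct_sumE; by case: w => [|? ?]; rewrite /= ?pr_sum ?big1.
have covd1 : covd (lamA (A := A)) D (cst e) = fun u => (D u : 'Hom(E, E)) e.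
  apply/funext => w; rewrite /covd addfE /hvf ush0 ?oppr0 ?add0r => [|a b]; last first.
    by rewrite /cst scaler0.
  have [DL _ _] := hD.
  have D0 : linear (fun phi : homG E E => (phi : 'Hom(E, E)) e).
    by move=> c f g; rewrite add_lfunE scale_lfunE.
  (* In the product with a constant series only the unshuffle with empty first block contributes. *)
  have -> : (D w : 'Hom(E, E)) e = ush (fun a b => if a is [::] then (D b : 'Hom(E, E)) e else 0) w.
    elim: w (D) DL => [|v w IHw] D' DL' //=.
    rewrite ush0 => [|a b] //; rewrite add0r.
    rewrite (linear_pr v (f := fun v => (D' (v :: w) : 'Hom(E, E)) e)); last first.
      by move=> c x y; rewrite (ml_head w DL') D0.
    apply: eq_bigr => n _; rewrite (IHw _ (ml_iot (pr SA n v) DL')).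
    by apply: eq_ush => -[].
  apply: eq_ush => -[|? ?] b /=; last by rewrite big1 // => k _; rewrite linear0.
  by rewrite -(linear_fun_sum _ _ _ D0) pr_sum.
have /= := D2 _ cst_series; rewrite covd1 => /(congr1 (fun f => f u)); rewrite /covd addfE zerofE.
move=> <-; rewrite /curv addfE add_lfunE; congr (_ + _).
  rewrite /hvf opp_lfunE; congr (- _).
  rewrite (ush_push _ _ (psi := fun phi : homG E E => (phi : 'Hom(E, E)) e)); last first.
    by move=> c f g; rewrite add_lfunE scale_lfunE.
  by apply: eq_ush => a b; rewrite scale_lfunE.
rewrite /scomp /sapp /sprod (ush_push _ _ (psi := fun phi : homG E E => (phi : 'Hom(E, E)) e)); last first.
  by move=> c f g; rewrite add_lfunE scale_lfunE.
apply: eq_ush => a b; rewrite sum_lfunE; apply: eq_bigr => k _.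
by rewrite comp_lfunE.
Qed.
End Pair.

(** * Exactness of alpha(x) r *)

Section Key.
Variables (K : fieldType) (L : linfty K) (A : subalg L).
Implicit Types V W E F : gvect K.
Local Notation sg := (@sg K).
Local Notation SA := (subA A).
Local Notation B := (quoLA A).
Local Notation incl := (@inclA K L A).
Local Notation proj := (@projB K L A).
Local Notation glift := (@glift K L A).
Local Notation retr := (@retr K L A).
Local Notation restr f := (@restrA K L A _ f).
Local Notation mu := (twist (lam L)).
Local Notation lamA := (lamA (A := A)).
Local Notation DB := (DB (A := A)).

Let hmu : hform 1 mu := twist_hform (lam_hform L).
Let hmuA : hform 1 (twist lamA) := twist_hform (lamA_hform A).

Lemma proj_eq v w : proj v = proj w -> v - w \in (A : {vspace L}).
Proof.
move=> vw; rewrite -proj_eq0 (linear_funD (@proj_linear _ _ A)) vw.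
by rewrite -(linear_funD (@proj_linear _ _ A)) subrr (linear_fun0 (@proj_linear _ _ A)).
Qed.

Lemma sub_incl (v : L) : v \in (A : {vspace L}) -> exists a, v = incl a.
Proof. by move=> vA; exists (vsproj A v); rewrite /inclA vsprojK. Qed.

(** Two lifts of the same class differ by a vector of A, and [lam] maps lists from A into A. *)
Lemma proj_lam_rcons u v w : proj v = proj w ->
  proj (lam L (rcons (map incl u) v)) = proj (lam L (rcons (map incl u) w)).
Proof.
move=> /proj_eq/sub_incl[a vw]; have -> : v = 1 *: w + incl a by rewrite -vw scale1r addrC subrK.
rewrite -!cats1 (ml_hform (lam_hform L)) scale1r (linear_funD (@proj_linear _ _ A)).
rewrite -[RHS]addr0; congr (_ + _).
by rewrite -[[:: incl a]]/(map incl [:: a]) -map_cat -incl_lamA proj_incl.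
Qed.

(** Only the class of the lift modulo A matters, so the graded section can take the place of
    [liftB]. *)
Lemma DBE u b : (DB u : 'Hom(B, B)) b =
  (-1) ^+ size u *: proj (lam L (rcons (map incl u) (glift b))).
Proof.
rewrite /Defs.DB linfun_linE => [|c x y].
  by rewrite (@proj_lam_rcons _ _ (glift b)) // proj_lift proj_glift.
rewrite lift_linear -cats1 (ml_hform (lam_hform L)) !cats1.
by rewrite (@proj_linear _ _ A) scalerDr !scalerA mulrC.
Qed.

(* The twists are those for which both the differential of x ([proj_vbracket])
   and the contraction of the Atiyah cocycle with x ([sapp_atiyah]) are
   expressed by this vector field. *)
Definition vfield (p : int) (x : seq SA -> B) : seq L -> L :=
  fun u => glift (Kl 1 (Kr p x) (map retr u)).

Lemma vfield_hform p d x : hform d x -> hform d (vfield p x).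
Proof.
move=> hx; rewrite -[d]addr0.
apply: (hform_push (f := fun u => Kl 1 (Kr p x) (map retr u))).
- exact: glift_linear.
- by move=> n v hv; rewrite addr0; apply: homog_glift.
apply: hform_pull; first exact: retr_linear.
- by move=> n v; apply: homog_retr.
exact: hform_Kl (hform_Kr p hx).
Qed.

Lemma vfield_incl p x u : vfield p x (map incl u) = glift (Kl 1 (Kr p x) u).
Proof. by rewrite /vfield map_retr_incl. Qed.

Lemma Kl1KrE p (x : seq SA -> B) e u : hform p x -> homogs e u ->
  Kl 1 (Kr p x) u =
  sg (p + \sum_(k <- e) k + p * \sum_(k <- e) k) *: x u.
Proof.
move=> hx hu; have [xL _ xd] := hx.
rewrite /Kl /Kr (ml_kos p xL hu) linearZ /= (kos_homog _ (xd _ _ hu)).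
by rewrite scalerA -sgD mul1r addrC.
Qed.

(* [mu, X] for X of degree p *)
Definition vbracket (p : int) (X : seq L -> L) : seq L -> L :=
  ins mu X - sg p *: ins X mu.

Lemma vbracket_hform p X : hform p X -> hform (1 + p) (vbracket p X).
Proof.
move=> hX; rewrite /vbracket [Y in hform _ Y]addrC -scaleNr.
apply: hform_lin; last exact: ins_hform.
by apply: hform_cast (ins_hform hX hmu); rewrite addrC.
Qed.

(** On A and modulo A, [ins mu X] is the derivative of [x] along Q_A, while [ins X mu] brackets one
    vector of the complement with vectors of A, which is the action [DB] on [x]. *)
Lemma proj_vbracket p x u : hform 1 DB -> hform p x ->
  proj (vbracket p (vfield p x) (map incl u)) = Kr p (covd lamA DB x) u.
Proof.
move=> hDB hx; have hX := vfield_hform p hx.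
have projL := @proj_linear _ _ A.
rewrite /vbracket addfE oppfE scalefE (linear_funD projL) -scaleNr (linear_funZ projL).
rewrite /covd KrD addfE; congr (_ + _).
  have -> : proj (ins mu (vfield p x) (map incl u)) =
      ins (twist lamA) (Kl 1 (Kr p x)) u.
    rewrite /ins restr_ush (ush_push _ _ projL); apply: eq_ush => a b.
    by rewrite twist_incl -[_ :: map incl b]/(map incl (_ :: b)) vfield_incl proj_glift.
  rewrite ins_Kl (ins_Kr p hmuA (ml_hform hx)) mulr1 (hvfE _ (ml_hform hx)).
  have hmx := ins_hform hmuA hx.
  rewrite (KlE 1 (hformZ _ (hform_Kr p hmx))) KrZ scalerA -sgD mul1r.
  rewrite (_ : sg (1 + p + p) = -1) ?scaleN1r; last by rewrite -addrA sgD sg1 sg_even mulr1.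
  by rewrite KrC.
have xL := ml_hform hx; have DL := ml_hform hDB.
pose g1 a b := - sg p *: proj (mu (vfield p x (map incl a) :: map incl b)).
have g1L : biml g1.
  have scL (phi : L -> L) : linear phi -> linear (fun v => - sg p *: proj (phi v)).
    by move=> pL c y z; rewrite pL projL scalerDr !scalerA mulrC.
  split=> [b|a].
    apply: (ml_comp (psi := fun v => - sg p *: proj (mu (v :: map incl b)))).
      exact: scL (ml_head _ (ml_hform hmu)).
    exact: ml_map (@incl_linear _ _ A) (ml_hform hX).
  apply: (ml_comp (psi := fun v => - sg p *: proj v)); first exact: (scL id).
  exact: ml_map (@incl_linear _ _ A) (ml_iot _ (ml_hform hmu)).
have -> : - sg p *: proj (ins (vfield p x) mu (map incl u)) = ush g1 u.
  by rewrite /ins restr_ush (ush_push _ _ projL) -ushZ.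
move: u; apply: ml_ext => [||e u hu].
- exact: ush_ml.
- exact: ml_Kr (ml_hform (sapp_hform hDB hx)).
rewrite /Kr (ml_kos p (ml_hform (sapp_hform hDB hx)) hu) /sapp /sprod -ushZ.
apply: (eq_ush_homogs hu) => [a||ea eb a b ha hb sab eab].
- exact: g1L.2.
- move=> a; apply: (ml_scale (sg (p * \sum_(k <- e) k))).
  exact: (sprod_summand_biml (pairing_app B B) DL xL).2.
have [_ _ Dd] := hDB; have [_ _ xd] := hx.
rewrite (sprod_summand_homog (pairing_app B B) _ _ (Dd _ _ hb)).
rewrite (ml_kos _ xL ha) linearZ /= scalerA.
rewrite /g1 vfield_incl (Kl1KrE hx ha) (linear_funZ (@glift_linear _ _ A)).
rewrite (linear_funZ (ml_head _ (ml_hform hmu))) (linear_funZ projL) scalerA.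
rewrite (gs_rcons (gs_hform hmu) (homog_glift (xd _ _ ha)) (homogs_incl hb)).
rewrite (linear_funZ projL) scalerA DBE /twist size_rcons size_map exprS mulN1r.
rewrite scaleNr (linear_funN projL) (linear_funZ projL) scalerN -scaleNr.
congr (_ *: _); rewrite !mulNr opprK -!sgD -eab.
apply: (@sg_par _ _ _ p); ring.
Qed.

(** The pre-Lie form of [[mu, [mu, X]] = [[mu, mu], X] / 2]. [E2] is the symmetry of the associator
    of [X], [mu], [mu], in which mu o mu = 0 removes one term. *)
Lemma vbracket_vbracket (charK0 : [pchar K] =i pred0) p X : hform p X ->
  vbracket (1 + p) (vbracket p X) = 0.
Proof.
move=> hX; have mm0 := twist_twist L; have hmX := ins_hform hmu hX.
have hXm := ins_hform hX hmu; have mL := ml_hform hmu.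
have E1 : ins mu (vbracket p X) = - sg p *: ins mu (ins X mu).
  by rewrite /vbracket -scaleNr insDr insZr (ins_sq0 charK0 hmu mm0 hX) add0r.
have E2 : ins (vbracket p X) mu = ins mu (ins X mu).
  rewrite /vbracket -scaleNr insDl // insZl //.
  have := assoc_sym hX hmu hmu; rewrite /assoc mm0 ins0r sub0r mulr1.
  by rewrite scaleNr -scalerN => ->; rewrite scalerA sgK scale1r addrC subrK.
by rewrite /vbracket -/(vbracket p X) E1 E2 sgD sg1 mulN1r !scaleNr opprK addNr.
Qed.

Section Exact.
Variables (E : gvect K) (DL : seq L -> homG E E).
Hypothesis hDL : hform 1 DL.
Hypothesis flat : restr (curv (lam L) DL) = 0.
Let R : seq L -> homG E E := curv (lam L) DL.

Lemma curv_hform : hform 2 R.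
Proof.
apply: hformD; first exact: (hvf_hform (lam_hform L) hDL).
exact: (scomp_hform hDL hDL).
Qed.

(** A field that is tangent along A feeds only vectors of A to [G]. *)
Lemma restr_ins_vanish W X (G : seq L -> W) : multilinear G ->
  (forall u, X (map incl u) \in (A : {vspace L})) -> restr G = 0 -> restr (ins X G) = 0.
Proof.
move=> GL XA G0; apply/funext => u; rewrite /restrA /ins restr_ush.
apply: ush0 => a b; have [c ->] := sub_incl (XA a).
by rewrite -[_ :: _]/(map incl (c :: b)) -[G _]/(restr G _) G0.
Qed.

(** The two lifts of [b] differ by a vector of A, on which [R] vanishes by [flat]. As [glift b] is
    homogeneous, the sum over [supp L] then collapses. *)
Lemma atiyahE (b : B) n u : homog n b ->
  ((atiyah_cocycle DL u : homG B (homG E E)) : 'Hom(B, homG E E)) b =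
  kos n (R (glift b :: map incl u)).
Proof.
move=> hb; have RL := ml_hform curv_hform.
pose rho (l : L) : homG E E := \sum_(m <- supp L) kos m (R (pr L m l :: map incl u)).
have rhoL : linear rho.
  move=> c x y; rewrite /rho scaler_sumr -big_split; apply: eq_bigr => m _ /=.
  by rewrite linearP (ml_head _ RL) linearP.
rewrite /atiyah_cocycle linfun_linE -/(rho _); last first.
  by move=> c x y; rewrite lift_linear; apply: rhoL.
have -> : rho (liftB b) = rho (glift b).
  have /proj_eq/sub_incl[a ab] : proj (liftB b) = proj (glift b).
    by rewrite proj_lift proj_glift.
  apply/eqP; rewrite -subr_eq0 -(linear_funN rhoL) -(linear_funD rhoL) ab.
  rewrite /rho big1 // => m _; rewrite -incl_pr -[_ :: _]/(map incl (_ :: u)).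
  by rewrite -[R _]/(restr R _) flat linear0.
have hg := homog_glift hb.
apply: (sum_homog (F := fun m v => kos m (R (v :: map incl u)))) hg => m.
by rewrite (linear_fun0 (ml_head _ RL)) linear0.
Qed.

(** Along A the field takes the values [glift (x a)] up to sign, and inserting such a vector in
    front of the arguments of [R] is, by [atiyahE], the action of the cocycle. *)
Lemma sapp_atiyah p (x : seq SA -> B) : hform p x ->
  sapp (atiyah_cocycle DL) x = restr (Kr p (ins (vfield p x) R)).
Proof.
move=> hx; have [xL _ xd] := hx; have [RL _ Rd] := curv_hform.
have XL := ml_hform (vfield_hform p hx).
have aL : multilinear (atiyah_cocycle (A := A) DL).
  move=> s t c y z; apply/lfunP; apply: linear_ext => [k v w|k v w|n b hb]; rewrite ?linearP //.
  rewrite add_lfunE scale_lfunE !(atiyahE _ hb).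
  exact: (ml_comp (@kos_linear _ _ n) (ml_map (@incl_linear _ _ A) (ml_iot (glift b) RL))).
have ad e u : homogs e u -> homog (2 + \sum_(k <- e) k)
    (atiyah_cocycle DL u : homG B (homG E E)).
  move=> hu; apply/homog_homP => n b hb; rewrite (atiyahE _ hb); apply: homog_kos.
  have := Rd (glift b :: map incl u) (n :: e).
  rewrite big_cons addrCA; apply.
  by apply/andP; split; [apply: homog_glift | apply: homogs_incl].
pose g1 a b := R (vfield p x (map incl a) :: map incl b).
have g1L : biml g1.
  split=> [b|a].
    apply: (ml_comp (psi := fun v => R (v :: map incl b))); first exact: ml_head.
    exact: ml_map (@incl_linear _ _ A) XL.
  exact: ml_map (@incl_linear _ _ A) (ml_iot _ RL).
apply/funext; apply: ml_ext => [||e u hu].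
- exact: (sprod_ml (pairing_app B (homG E E)) aL xL).
- rewrite restr_Kr; apply: ml_Kr.
  exact: (ml_map (@incl_linear _ _ A) (ush_ml (ins_biml XL RL))).
have -> : restr (Kr p (ins (vfield p x) R)) u = sg (p * \sum_(k <- e) k) *: ush g1 u.
  rewrite restr_Kr /Kr (ml_kos p _ hu); last first.
    exact: (ml_map (@incl_linear _ _ A) (ush_ml (ins_biml XL RL))).
  by rewrite /restrA /ins restr_ush.
rewrite -ushZ; apply: (eq_ush_homogs hu) => [a||ea eb a b ha hb sab eab].
- exact: (sprod_summand_biml (pairing_app B (homG E E)) aL xL).2.
- by move=> a; apply: (ml_scale (sg (p * \sum_(k <- e) k))); exact: g1L.2.
rewrite (sprod_summand_homog (pairing_app B (homG E E)) _ _ (ad _ _ hb)).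
rewrite (ml_kos _ xL ha) linearZ /= (atiyahE _ (xd _ _ ha)).
rewrite /g1 vfield_incl (Kl1KrE hx ha) (linear_funZ (@glift_linear _ _ A)).
rewrite (linear_funZ (ml_head _ RL)).
have hR : homog (2 + (p + \sum_(k <- ea) k + \sum_(k <- eb) k))
    (R (glift (x a) :: map incl b)).
  have := Rd (glift (x a) :: map incl b) ((p + \sum_(k <- ea) k) :: eb).
  rewrite big_cons; apply.
  by apply/andP; split; [apply/homog_glift/xd | apply: homogs_incl].
rewrite (kos_homog _ hR) !scalerA; congr (_ *: _); rewrite -eab -!sgD.
(* [n] is the degree of [x a]. Twisting the value by [kos n] produces the exponent [n * n], which
   has the parity of [n]. *)
set n := p + _; rewrite [n * _]mulrDr.
have -> : n * (n + \sum_(k <- eb) k) = n * n + n * \sum_(k <- eb) k by rewrite mulrDr.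
rewrite !sgD sg_sq -!sgD /n.
set ea' := \sum_(k <- ea) k.
apply: (@sg_par _ _ _ (p + 2 * ea' + ea' * \sum_(k <- eb) k - p * ea')).
ring.
Qed.

Lemma atiyah_exact p d (x : seq SA -> B) (r : seq SA -> E) :
  [pchar K] =i pred0 ->
  hform 1 DB -> hform p x -> hform d r ->
  covd lamA DB x = 0 -> covd lamA (restr DL) r = 0 ->
  exists2 y, hform (p + (1 + d)) y & covd lamA (restr DL) y = atiyah DL x r.
Proof.
move=> charK0 hDB hx hr dx0 dr0.
have hX := vfield_hform p hx; have hl := lam_hform L.
pose rt : seq L -> E := fun u => r (map retr u).
have hrt : hform d rt := hform_pull (@retr_linear _ _ A) (@homog_retr _ _ A) hr.
have rtE : restr rt = r by apply/funext => u; rewrite /restrA /rt map_retr_incl.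
pose G := covd (lam L) DL rt.
have hG : hform (1 + d) G := covd_hform hl hDL hrt.
have G0 : restr G = 0 by rewrite restr_covd rtE.
have hXG := ins_hform hX hG.
(* The factor [sg p] cancels the one in [covd_ins]. *)
exists (sg p *: restr (Kr p (ins (vfield p x) G))).
  exact/hformZ/hform_restr/hform_Kr.
rewrite -[r in RHS]rtE /atiyah (sapp_atiyah hx) /sapp -restr_sprod -/(sapp _ rt).
rewrite -restrZ -restr_covd. 
rewrite (linear_funZ (@covd_linear _ _ _ _ _)) (covd_ins hl hDL hX hG) -/(vbracket p _).
rewrite scalerA sgK scale1r [covd _ _ G](covd_sq charK0 hl (twist_twist L) hDL hrt).
rewrite -/R (ins_sapp hX curv_hform hrt).
(* The values of the field lie in the image of [glift], which [retr] kills. *)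
have -> : ins (vfield p x) rt = 0.
  apply/funext => u; apply: ush0 => a b; rewrite /rt /= /vfield retr_glift.
  exact: (linear_fun0 (ml_head _ (ml_hform hr))).
rewrite [sapp _ 0](sprod0r (pairing_app E E)) add0r.
rewrite [Kr p (sapp _ (Kr p rt))]Kr_sprod KrK -/(sapp _ rt).
have -> (f g : seq L -> E) : restr (f - g) = restr f - restr g by [].
(* The main terms agree; what remains to vanish on A are the two correction terms of [covd_ins]. *)
rewrite -[RHS]subr0; congr (_ - _).
rewrite restrD !restr_Kr restr_ins_vanish //; first last.
- move=> u; rewrite -proj_eq0 (proj_vbracket _ hDB hx) dx0.
  by rewrite /Kr zerofE eqxx.
- exact: ml_hform hG.
rewrite /sapp restr_sprod restr_Kr G0 Kr0 (sprod0r (pairing_app E E)).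
by rewrite !Kr0 addr0.
Qed.
End Exact.
End Key.

(** * Homogeneous components of series, and shifts *)

Section Series.
Variable K : fieldType.
Implicit Types V W E F : gvect K.

Lemma hform_series V W d (f : seq V -> W) : hform d f -> f \in @series K V W.
Proof.
move=> hf; apply/asboolP; exists [:: f]; last by rewrite big_seq1.
by move=> g; rewrite inE => /eqP ->; exists d.
Qed.

Lemma series_hform_ind V W (P : (seq V -> W) -> Prop) :
  P 0 -> (forall f g, P f -> P g -> P (f + g)) ->
  (forall d f, hform d f -> P f) -> {in @series K V W, forall f, P f}.
Proof.
move=> P0 PD Ph f /asboolP[F hF ->]; rewrite big_seq.
by elim/big_ind: _ => // g /hF[d]; apply: Ph.
Qed.

Lemma hform_sum V W d (I : Type) (r : seq I) (P : pred I) (F : I -> seq V -> W) :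
  (forall i, P i -> hform d (F i)) -> hform d (\sum_(i <- r | P i) F i).
Proof.
by move=> hF; elim/big_ind: _ => //; [apply: hform0 | move=> f g; apply: hformD].
Qed.

(** On homogeneous arguments of total degree e the value of [y d] has degree [d + e], so the
    projections [pr] separate the summands. *)
Lemma hform_direct V W (s : seq int) (y : int -> seq V -> W) : uniq s ->
  (forall d, hform d (y d)) -> \sum_(d <- s) y d = 0 ->
  {in s, forall d, y d = 0}.
Proof.
move=> us hy y0 d ds; apply/funext; apply: ml_ext => [||e u hu].
- exact: ml_hform (hy d).
- by move=> ? ? ? ? ?; rewrite !zerofE scaler0 addr0.
have /(congr1 (fun f => pr W (d + \sum_(k <- e) k) (f u))) := y0.
rewrite fct_sumE zerofE linear0 linear_sum (bigD1_seq d) //= [X in _ + X = _]big1 => [|d' dd].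
  have hyd : homog (d + \sum_(k <- e) k) (y d u) by have [_ _] := hy d; apply.
  by rewrite addr0 => <-; symmetry; apply/eqP.
have [_ _ /(_ u e hu) hd'] := hy d'.
by rewrite (pr_homog _ hd') (inj_eq (addIr _)) eq_sym (negbTE dd).
Qed.

(** As [d] has degree 1, the images of the components of [x] lie in distinct degrees; their sum
    being 0, each of them is 0. *)
Lemma cocycle_hform V W (d : (seq V -> W) -> seq V -> W) (x : seq V -> W) :
  linear d -> (forall n f, hform n f -> hform (1 + n) (d f)) ->
  x \in @series K V W -> d x = 0 ->
  exists F : seq (seq V -> W),
    {in F, forall g, exists n, hform n g /\ d g = 0} /\ x = \sum_(g <- F) g.
Proof.
move=> dL dd xS dx.
(* Degrees are stored with the summands, so that those of equal degree can be collected into one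
   component. *)
have [G [hG xE]] : exists G : seq (int * (seq V -> W)),
    (forall g, g \in G -> hform g.1 g.2) /\ x = \sum_(g <- G) g.2.
  move: x xS {dx}; apply: series_hform_ind => [|f g [F [hF ->]] [G [hG ->]]|n f hf].
  - by exists [::]; rewrite big_nil.
  - exists (F ++ G); rewrite big_cat; split=> // h.
    by rewrite mem_cat => /orP[/hF|/hG].
  by exists [:: (n, f)]; rewrite big_seq1; split=> // h; rewrite inE => /eqP ->.
pose y n := \sum_(g <- G | g.1 == n) g.2.
have hy n : hform n (y n).
  by rewrite /y big_seq_cond; apply: hform_sum => g /andP[/hG hg /eqP <-].
pose s := undup (map fst G).
have xy : x = \sum_(n <- s) y n.
  rewrite xE; under [RHS]eq_bigr => n _ do rewrite /y big_mkcond.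
  rewrite exchange_big big_seq [RHS]big_seq; apply: eq_bigr => g gG /=.
  rewrite (bigD1_seq g.1) ?undup_uniq ?mem_undup ?map_f //= eqxx big1 ?addr0 // => n.
  by rewrite eq_sym => /negbTE ->.
exists (map y s); split; last by rewrite big_map.
move=> _ /mapP[n ns ->]; exists n; split=> //.
(* [d (y n)] has degree [n + 1]; [z] indexes it by its own degree, as [hform_direct] requires. *)
pose z n := d (y (n - 1)).
have z0 : {in map (fun n => n + 1) s, forall n, z n = 0}.
  apply: hform_direct => [|m|].
  - by rewrite map_inj_uniq ?undup_uniq //; apply: addIr.
  - by rewrite -[X in hform X _](subrK 1 m) addrC; apply: dd.
  rewrite big_map -[RHS]dx xy (linear_fun_sum _ _ _ dL).
  by apply: eq_bigr => m _; rewrite /z addrK.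
by have := z0 (n + 1) (map_f _ ns); rewrite /z addrK.
Qed.

Lemma covd_series V E (lam : seq V -> V) (D : seq V -> homG E E) :
  hform 1 lam -> hform 1 D ->
  {in @series K V E, forall r, covd lam D r \in @series K V E}.
Proof.
move=> hl hD; have dL := @covd_linear _ _ lam _ D.
apply: series_hform_ind => [|f g fS gS|d f hf].
- by rewrite (linear_fun0 dL) rpred0.
- by rewrite (linear_funD dL f g) rpredD.
exact: hform_series (covd_hform hl hD hf).
Qed.

Lemma hform_shift V W k d (f : seq V -> W) :
  @hform K V (shiftG W k) d f <-> hform (d + k) f.
Proof.
have E e : d + k + e = d + e + k by rewrite addrAC.
by split=> -[fL fS fd]; split=> // u e hu; have := fd u e hu;
  rewrite /homog ?E // -E.
Qed.

(** A shift only relabels the degrees, which allows the argument to be carried out for B in place of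
    B[-2]. *)
Lemma series_shift V W k (f : seq V -> W) :
  f \in @series K V (shiftG W k) <-> f \in @series K V W.
Proof.
split.
  move: f; apply: (@series_hform_ind V (shiftG W k)) => [|f g|d f hf].
  - exact: (rpred0 (@series K V W)).
  - exact: (@rpredD _ (@series K V W)).
  by apply: (@hform_series _ W (d + k)); apply/hform_shift.
move: f; apply: (@series_hform_ind V W) => [|f g|d f hf].
- exact: (rpred0 (@series K V (shiftG W k))).
- exact: (@rpredD _ (@series K V (shiftG W k))).
apply: (@hform_series _ (shiftG W k) (d - k)); apply/hform_shift.
by rewrite subrK.
Qed.
End Series.

(** * Classes of coboundaries *)

Section Coh.
Variables (K : fieldType) (U : lmodType K) (C : submodClosed U) (d : {linear U -> U}).

Lemma cocycle0 : 0 \in cocycle C d.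
Proof. exact: (rpred0 (cocycle C d)). Qed.

Lemma cls0 : cls C d 0 = 0.
Proof.
have := cls_linear 1 cocycle0 cocycle0; rewrite !scale1r addr0.
by rewrite -{1}[cls C d 0]addr0 => /addrI.
Qed.

Lemma cls_exact c y : c \in cocycle C d -> y \in C -> d y = c -> cls C d c = 0.
Proof.
move=> Zc yC dy; rewrite -cls0; apply/(cls_eq Zc cocycle0).
by exists y; rewrite ?subr0.
Qed.
End Coh.

(** * The module structure on L/A, and exactness for general cocycles *)

Section Pair.
Variables (K : fieldType) (charK0 : [pchar K] =i pred0) (L : linfty K) (A : subalg L).
Local Notation SA := (subA A).
Local Notation B := (quoLA A).
Local Notation incl := (@inclA K L A).
Local Notation proj := (@projB K L A).
Local Notation lamA := (lamA (A := A)).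
Local Notation DB := (DB (A := A)).
Local Notation mu := (twist (lam L)).
Local Notation sg := (@sg K).

Lemma vbracket_lin p c (X Y : seq L -> L) :
  vbracket p (c *: X + Y) = c *: vbracket p X + vbracket p Y.
Proof.
have mL := ml_hform (twist_hform (lam_hform L)).
rewrite /vbracket ins_linr ins_linl // !scalerDr opprD addrACA scalerN !scalerA.
by rewrite [sg p * c]mulrC.
Qed.

(** As A is a subalgebra, [mu] maps lists from A into A; if [X] does so too, then both insertions
    do. *)
Lemma vbracket_tangent p (X : seq L -> L) :
  (forall u, X (map incl u) \in (A : {vspace L})) ->
  forall u, vbracket p X (map incl u) \in (A : {vspace L}).
Proof.
move=> XA u; rewrite -proj_eq0; have projL := @proj_linear _ _ A.
rewrite /vbracket addfE oppfE scalefE (linear_funD projL) -scaleNr (linear_funZ projL).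
rewrite /ins !restr_ush !(ush_push _ _ projL) !ush0 ?scaler0 ?addr0 // => a b; apply/eqP; rewrite proj_eq0.
  have [c ->] := sub_incl (XA a).
  by rewrite -[_ :: _]/(map incl (c :: b)) twist_incl incl_in.
by rewrite twist_incl -[_ :: _]/(map incl (_ :: b)) XA.
Qed.

(** By [proj_vbracket], the vector field [X1] of [d x] equals, up to sign, [[mu, X]] on A modulo A.
    The difference is tangent along A, and so is its bracket with [mu]. Hence d(d x) is, up to sign
    and twist, the class modulo A of [[mu, [mu, X]] = 0]. *)
Lemma module_DB : hform 1 DB -> is_module DB.
Proof.
move=> hDB; split=> // r rS; move: r rS.
have dL := @covd_linear _ _ lamA _ DB.
apply: series_hform_ind => [|f g Hf Hg|p x hx].
- by rewrite !(linear_fun0 dL).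
- by rewrite (linear_funD dL f g) (linear_funD dL (covd _ _ f) (covd _ _ g)) Hf Hg addr0.
have hx1 := covd_hform (lamA_hform A) hDB hx.
set x1 := covd lamA DB x in hx1 *.
pose Z := vbracket p (vfield p x); pose X1 := vfield (1 + p) x1.
have hZ : hform (1 + p) Z := vbracket_hform (vfield_hform p hx).
have X1Z u : (X1 - sg (1 + p) *: Z) (map incl u) \in (A : {vspace L}).
  rewrite -proj_eq0 addfE oppfE scalefE -scaleNr.
  have projL := @proj_linear _ _ A.
  rewrite (linear_funD projL) (linear_funZ projL) (proj_vbracket _ hDB hx) -/x1.
  rewrite /X1 vfield_incl proj_glift -[Kr (1 + p) x1]Kr_Kr (KrE 1 (hform_Kr p hx1)).
  rewrite mul1r /Kl scalefE linearZ /= kosK.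
  by rewrite -scalerDl subrr scale0r.
rewrite -[covd _ _ x1](KrK (1 + p)); apply/funext => u.
rewrite {1}/Kr -(proj_vbracket _ hDB hx1) -/X1 zerofE.
apply/eqP; rewrite proj_eq0.
have -> : vbracket (1 + p) X1 = vbracket (1 + p) (X1 - sg (1 + p) *: Z).
  rewrite [X1 - _]addrC -scaleNr vbracket_lin (vbracket_vbracket charK0 (vfield_hform p hx)).
  by rewrite scaler0 add0r.
exact: vbracket_tangent.
Qed.

Section Module.
Variables (E : gvect K) (DE : seq SA -> homG E E) (DL : seq L -> homG E E).
Hypotheses (modE : is_module DE) (conn : is_connection DE DL) (hDB : hform 1 DB).

Lemma atiyah_exact_series (x : seq SA -> B) (r : seq SA -> E) :
  x \in @series K SA B -> r \in @series K SA E ->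
  covd lamA DB x = 0 -> covd lamA DE r = 0 ->
  exists2 y, y \in @series K SA E & covd lamA DE y = atiyah DL x r.
Proof.
move=> xS rS dx dr; have [hDL rDL] := conn; have hDE := modE.1.
have flat : restrA (curv (lam L) DL) = 0 :> (seq SA -> homG E E).
  by rewrite restr_curv rDL (module_flat modE).
have hl := lamA_hform A.
have [F [hF ->]] := cocycle_hform (@covd_linear _ _ lamA _ DB)
  (fun n f => covd_hform hl hDB) xS dx.
have [G [hG ->]] := cocycle_hform (@covd_linear _ _ lamA _ DE)
  (fun n f => covd_hform hl hDE) rS dr.
pose ex z := exists2 y, y \in @series K SA E & covd lamA DE y = z.
have ex0 : ex 0 by exists 0; rewrite ?rpred0 ?(linear_fun0 (@covd_linear _ _ _ _ _)).
have exD z z' : ex z -> ex z' -> ex (z + z').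
  move=> [y yS <-] [y' yS' <-]; exists (y + y'); first exact: rpredD.
  by rewrite (linear_funD (@covd_linear _ _ _ _ _)).
(* Bilinearity reduces the claim to homogeneous cocycles. *)
have -> : atiyah DL (\sum_(f <- F) f) (\sum_(g <- G) g) =
    \sum_(f <- F) \sum_(g <- G) atiyah DL f g.
  pose al := atiyah_cocycle (A := A) DL.
  have lL (h : seq SA -> E) : linear (fun Phi : seq SA -> homG E E => sapp Phi h).
    by move=> c Phi Psi; rewrite sappDl sappZl.
  rewrite /atiyah -/al (linear_fun_sum F predT id (sapp_linear al)).
  rewrite (linear_fun_sum _ _ _ (lL _)); apply: eq_bigr => f _.
  exact: (linear_fun_sum G predT id (sapp_linear _)).
rewrite -/(ex _) big_seq; elim/big_ind: _ => // f /hF[p [hf df]].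
rewrite big_seq; elim/big_ind: _ => // g /hG[q [hg dg]].
have [|y hy dy] := atiyah_exact hDL flat charK0 hDB hf hg df.
  by rewrite rDL.
by exists y; [apply: hform_series hy | rewrite -dy rDL].
Qed.
End Module.
End Pair.

(** * The zero bracket and the zero action *)

Section ZeroLie.
Variables (K : fieldType) (H M : lmodType K).
Variables (degH : int -> H -> Prop) (degM : int -> M -> Prop).

Lemma zero_lie : (forall n, degH n 0) -> graded_lie degH (fun _ _ => 0).
Proof.
move=> d0; split=> // [|m n x y _ _|m n p x y z _ _ _].
- by split=> x c y z; rewrite scaler0 addr0.
- by rewrite scaler0 oppr0.
by rewrite scaler0 addr0.
Qed.

Lemma zero_lie_module (br : H -> H -> H) : (forall n, degM n 0) ->
  graded_lie_module degH degM br (fun _ _ => 0).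
Proof.
move=> d0; split=> // [|m n p x y r _ _ _].
- by split=> x c y z; rewrite scaler0 addr0.
by rewrite scaler0 subr0.
Qed.
End ZeroLie.

Lemma degCE0 (K : fieldType) (V W : gvect K)
  (d : {linear (seq V -> W) -> (seq V -> W)}) n : @degCE K V W d n 0.
Proof.
exists 0; split; [exact: hform0 | exact: cocycle0 |].
by rewrite /clsCE cls0.
Qed.

Theorem mainTheorem2 (K : fieldType) (charK0 : [pchar K] =i pred0)
    (L : linfty K) (A : subalg L)
    (nablaB : seq L -> homG (quoLA A) (quoLA A))
    (nablaB_ext : is_connection (DB (A := A)) nablaB) :
  let dB := @dCE K L A (quoLA A) (DB (A := A)) in
  let dB2 : {linear (seq (subA A) -> shiftG (quoLA A) (- 2)) ->
                    (seq (subA A) -> shiftG (quoLA A) (- 2))} := dB in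
  exists br : HCE dB2 -> HCE dB2 -> HCE dB2,
  [/\ {in cocycleCE dB2 &, forall x y,
         atiyah nablaB x y \in cocycleCE dB2 /\
         br (clsCE dB2 x) (clsCE dB2 y) = clsCE dB2 (atiyah nablaB x y)},
      graded_lie (@degCE _ _ _ dB2) br
    & forall (E : gvect K) (DE : seq (subA A) -> homG E E)
        (nablaE : seq L -> homG E E),
      is_module DE -> is_connection DE nablaE ->
      exists act : HCE dB2 -> HCE (dCE DE) -> HCE (dCE DE),
        {in cocycleCE dB2 & cocycleCE (dCE DE), forall x r,
           atiyah nablaE x r \in cocycleCE (dCE DE) /\
           act (clsCE dB2 x) (clsCE (dCE DE) r)
             = clsCE (dCE DE) (atiyah nablaE x r)} /\
        graded_lie_module (@degCE _ _ _ dB2) (@degCE _ _ _ (dCE DE)) br act].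
Proof.
move=> dB dB2.
(* [DB] is the restriction of [nablaB], from which it inherits multilinearity, symmetry and
   degree. *)
have hDB : hform 1 (DB (A := A)).
  by have [hN <-] := nablaB_ext; apply: hform_restr.
have modB := module_DB charK0 hDB.
have ZB x : x \in cocycleCE dB2 -> x \in @series K (subA A) (quoLA A) /\ dB x = 0.
  case/andP=> xS /eqP dx; split; last exact: dx.
  exact: ((@series_shift K (subA A) (quoLA A) (-2) x).1 xS).
exists (fun _ _ => 0); split.
- move=> x y /ZB[xS dx] /ZB[yS dy].
  have [z zS dz] := atiyah_exact_series charK0 modB nablaB_ext hDB xS yS dx dy.
  have zS2 := (@series_shift K (subA A) (quoLA A) (-2) z).2 zS.
  have aS : atiyah nablaB x y \in cocycleCE dB2.
    apply/andP; rewrite -dz; split; last exact/eqP/(modB.2 z zS).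
    apply: (@series_shift K (subA A) (quoLA A) (-2) _).2.
    exact: covd_series (lamA_hform A) hDB _ zS.
  split; first exact: aS.
  exact: (esym (cls_exact aS zS2 dz)).
- by apply: zero_lie => n; apply: degCE0.
move=> E DE nablaE modE conn; exists (fun _ _ => 0); split; last first.
  by apply: zero_lie_module => n; apply: degCE0.
move=> x r /ZB[xS dx] /andP[rS /eqP dr].
have [z zS dz] := atiyah_exact_series charK0 modE conn hDB xS rS dx dr.
have aS : atiyah nablaE x r \in cocycleCE (dCE DE).
  rewrite -dz; apply/andP; split; last exact/eqP/(modE.2 z zS).
  exact: covd_series (lamA_hform A) modE.1 _ zS.
split; first exact: aS.
exact: (esym (cls_exact aS zS dz)).
Qed.
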